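(* Let $\mathbf{k}$ be a field and $B = \mathbf{k}[x,y,z]/(xy,yz,xz)$ with its standard grading. The following three cones in $\mathbf{V}$ are equal: (i) the cone $\mathrm{B}^f_{\mathbf{Q}}(B)$, i.e. the $\mathbf{Q}_{\ge 0}$-span of the Betti tables $\beta^B(M)$ of all finite length graded $B$-modules $M$; (ii) the cone $D^f$, i.e. the $\mathbf{Q}_{\ge 0}$-span of the tables $\pi_d$ for all $B$-degree sequences $d$ with $d_1 < \infty$; (iii) the cone $F^f\subseteq \mathbf{V}$ defined as the intersection of the halfspaces $\{\epsilon_{i,j} \ge 0\}$ for all $i \ge 0$ and $j \in \mathbf{Z}$, the halfspaces $\{\alpha_k \ge 0\}$ for all $k \in \mathbf{Z}$, the halfspaces $\{\gamma_k \ge 0\}$ for all $k \in \mathbf{Z}$, the subspaces $\{2\epsilon_{i,j} - \epsilon_{i+1,j+1} = 0\}$ for all $i \ge 2$ and $j \in \mathbf{Z}$, and the subspace $\{\gamma_\infty = 0\}$.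
   Context: $\mathbf{V}$ is the $\mathbf{Q}$-vector space of tables $v=(v_{i,j})$ of rational numbers, indexed by integers $i \ge 0$ and $j \in \mathbf{Z}$, such that for each $i$ there are only finitely many $j$ with $v_{i,j} \ne 0$. For a finitely generated graded $B$-module $M$, its Betti table $\beta^B(M) \in \mathbf{V}$ has entries $\beta^B(M)_{i,j} = \dim_{\mathbf{k}} \operatorname{Tor}^B_i(M,\mathbf{k})_j$. A $B$-degree sequence is a sequence $d$ of one of the three forms $(d_0,\infty,\infty,\dots)$, $(d_0,d_1,\infty,\infty,\dots)$, $(d_0,d_1,d_1+1,d_1+2,\dots)$ with $d_0, d_1$ integers and $d_0<d_1$ (in the third form $d_i = d_1 + i-1$ for $i \ge 1$); the condition $d_1<\infty$ means $d$ is of the second or third form. For each such $d$ define $\pi_d \in \mathbf{V}$ as follows. In all cases $(\pi_d)_{0,j} = 1$ if $j=d_0$ and $0$ otherwise. - If $d=(d_0,\infty,\infty,\dots)$, then $(\pi_d)_{i,j}=0$ for all $i \ge 1$ and all $j$. - If $d=(d_0,d_1,\infty,\dots)$, then $(\pi_d)_{1,j}=1$ if $j=d_1$ and $0$ otherwise, and $(\pi_d)_{i,j}=0$ for $i\ge 2$. - If $d=(d_0,d_1,d_1+1,d_1+2,\dots)$, then for $i \ge 1$, $(\pi_d)_{i,j} = 3\cdot 2^{i-1}$ if $j=d_i$ and $0$ otherwise. For $v\in\mathbf{V}$ the linear functionals are $$\epsilon_{i,j}(v)=v_{i,j},\qquad \alpha_k(v) = 2\epsilon_{1,k}(v)-\epsilon_{2,k+1}(v),\qquad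 \gamma_k(v)=\sum_{j\le k}\bigl(3\epsilon_{0,j}(v)-3\epsilon_{1,j+1}(v)+\epsilon_{2,j+2}(v)\bigr),$$ and $\gamma_\infty(v)=\sum_{j\in\mathbf{Z}}\bigl(3\epsilon_{0,j}(v)-3\epsilon_{1,j+1}(v)+\epsilon_{2,j+2}(v)\bigr)$; these sums have only finitely many nonzero terms. *)

(* Defs.v *)
From Stdlib Require Import ClassicalEpsilon.
From HB Require Import structures.
From mathcomp Require Import all_boot all_order all_algebra finmap.
From mathcomp Require Import generic_quotient ring_quotient.
From mathcomp Require Import mpoly ring.

Set Implicit Arguments.
Unset Strict Implicit.
Unset Printing Implicit Defensive.

Import Order.TTheory GRing.Theory Num.Theory.

Local Open Scope ring_scope.
Local Open Scope quotient_scope.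

(* Ideals of [ring_quotient] are boolean predicates, so membership in the
   generated ideal (xy, yz, xz) is decided classically. *)
Definition axes_ideal (k : fieldType) (p : {mpoly k[3]}) : bool :=
  if excluded_middle_informative
    (exists a b c : {mpoly k[3]},
       p = a * ('X_0 * 'X_1) + b * ('X_1 * 'X_2%R) + c * ('X_0 * 'X_2%R))
  then true else false.

Lemma axes_idealP (k : fieldType) (p : {mpoly k[3]}) :
  reflect (exists a b c : {mpoly k[3]},
       p = a * ('X_0 * 'X_1) + b * ('X_1 * 'X_2%R) + c * ('X_0 * 'X_2%R))
    (axes_ideal p).
Proof.
by rewrite /axes_ideal; case: excluded_middle_informative => H; constructor.
Qed.

Lemma axes_ideal_coef0 (k : fieldType) (p : {mpoly k[3]}) :
  axes_ideal p -> p@_0%MM = 0.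
Proof.
move=> /axes_idealP[a [b [c ->]]].
have X0 i : ('X_i : {mpoly k[3]})@_0%MM = 0.
  by rewrite mcoeffX; case: eqP => // /(congr1 mdeg); rewrite mdeg0 mdeg1.
by rewrite !mcoeffD !(rmorphM (mcoeff 0%MM)) /= !X0 !(mulr0, addr0).
Qed.

Lemma axes_ideal_closed (k : fieldType) : idealr_closed (@axes_ideal k).
Proof.
split.
- by apply/axes_idealP; exists 0, 0, 0; rewrite !mul0r !addr0.
- apply/negP => /axes_ideal_coef0 /eqP.
  by rewrite mcoeff1 eqxx oner_eq0.
- move=> r p q /axes_idealP[a [b [c ->]]] /axes_idealP[a' [b' [c' ->]]].
  apply/axes_idealP; exists (r * a + a'), (r * b + b'), (r * c + c').
  ring.
Qed.

HB.instance Definition _ (k : fieldType) :=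
  isIdealr.Build {mpoly k[3]} (@axes_ideal k) (@axes_ideal_closed k).

Definition axes_idealr (k : fieldType) : idealr {mpoly k[3]} :=
  Idealr.clone {mpoly k[3]} (@axes_ideal k) _.

Notation axesRing k := {ideal_quot (axes_idealr k)}.

Definition axes_proj (k : fieldType) (p : {mpoly k[3]}) : axesRing k :=
  \pi_(axesRing k) p.

Definition axes_homog (k : fieldType) (n : int) (b : axesRing k) : Prop :=
  match n with
  | Posz m => exists2 p : {mpoly k[3]}, p \is m.-homog & b = axes_proj p
  | Negz _ => b = 0
  end.

(* The residue map B -> k = B / (x, y, z). *)
Definition axes_res (k : fieldType) (b : axesRing k) : k := (repr b)@_0%MM.

Lemma axes_res_proj (k : fieldType) (p : {mpoly k[3]}) :
  axes_res (axes_proj p) = p@_0%MM.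
Proof.
apply/eqP; rewrite -subr_eq0 -mcoeffB; apply/eqP/axes_ideal_coef0.
have := reprK (axes_proj p); rewrite /axes_proj => /eqP.
by rewrite -Quotient.idealrBE.
Qed.

Record gradedModule (k : fieldType) := GradedModule {
  gm_sort :> lmodType (axesRing k);
  gm_piece : int -> gm_sort -> Prop;
  gm_piece0 : forall j, gm_piece j 0;
  gm_pieceB : forall j x y, gm_piece j x -> gm_piece j y -> gm_piece j (x - y);
  gm_pieceM : forall n j b x,
    axes_homog n b -> gm_piece j x -> gm_piece (n + j) (b *: x);
  gm_span : forall x : gm_sort, exists (s : seq int) (f : int -> gm_sort),
    (forall j, gm_piece j (f j)) /\ x = \sum_(j <- s) f j;
  gm_direct : forall (s : seq int) (f : int -> gm_sort),
    uniq s -> (forall j, gm_piece j (f j)) -> \sum_(j <- s) f j = 0 ->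
    forall j, j \in s -> f j = 0
}.

Definition submodule (R : nzRingType) (M : lmodType R) (N : M -> Prop) : Prop :=
  N 0 /\ forall (b : R) (x y : M), N x -> N y -> N (b *: x + y).

Definition strict_subset (T : Type) (N N' : T -> Prop) : Prop :=
  (forall x, N x -> N' x) /\ exists x, N' x /\ ~ N x.

(* The lengths of strict chains N 0 < N 1 < ... < N l of (not necessarily
   graded) submodules are bounded. *)
Definition finite_length (R : nzRingType) (M : lmodType R) : Prop :=
  exists n : nat, forall (l : nat) (N : nat -> M -> Prop),
    (forall i, (i <= l)%N -> submodule (N i)) ->
    (forall i, (i < l)%N -> strict_subset (N i) (N i.+1)) ->
    (l <= n)%N.

(* A graded free resolution of M by finitely generated modules: the term F_i is
   the direct sum of the B(- fr_deg i s), an element of F_i is a row vector u,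
   the differential F_(i+1) -> F_i is u |-> u *m fr_diff i, and the augmentation
   F_0 -> M sends the s-th basis vector to fr_gen s. *)
Record freeResolution (k : fieldType) (M : gradedModule k) := FreeResolution {
  fr_rank : nat -> nat;
  fr_deg : forall i, 'I_(fr_rank i) -> int;
  fr_diff : forall i, 'M[axesRing k]_(fr_rank i.+1, fr_rank i);
  fr_gen : 'I_(fr_rank 0) -> M;
  fr_diff_homog : forall i s t,
    axes_homog (fr_deg s - fr_deg t) (fr_diff i s t);
  fr_gen_homog : forall s, gm_piece (fr_deg s) (fr_gen s);
  fr_gen_surj : forall x : M, exists u : 'rV[axesRing k]_(fr_rank 0),
    x = \sum_s u 0 s *: fr_gen s;
  fr_exact0 : forall u : 'rV[axesRing k]_(fr_rank 0),
    \sum_s u 0 s *: fr_gen s = 0 <-> exists w, u = w *m fr_diff 0;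
  fr_exact : forall i (u : 'rV[axesRing k]_(fr_rank i.+1)),
    u *m fr_diff i = 0 <-> exists w, u = w *m fr_diff i.+1
}.

(* Tor_i^B(M, k) is the homology of F (x)_B k, whose i-th term is
   k^(fr_rank i) and whose differentials are the fr_diff i with entries reduced
   along B -> k. Subspaces are row spaces of matrices. *)
Section Tor.
Variables (k : fieldType) (M : gradedModule k) (F : freeResolution M).

Definition tor_diff (i : nat) : 'M[k]_(fr_rank F i.+1, fr_rank F i) :=
  map_mx (@axes_res k) (fr_diff F i).

Definition tor_term (i : nat) (j : int) : 'M[k]_(fr_rank F i) :=
  diag_mx (\row_s (@fr_deg _ _ F i s == j)%:R).

Definition tor_cycles (i : nat) (j : int) : 'M[k]_(fr_rank F i) :=
  match i with
  | 0 => tor_term 0 j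
  | i'.+1 => (tor_term i'.+1 j :&: kermx (tor_diff i'))%MS
  end.

Definition tor_boundaries (i : nat) (j : int) :
    'M[k]_(fr_rank F i.+1, fr_rank F i) :=
  tor_term i.+1 j *m tor_diff i.

Definition tor_dim (i : nat) (j : int) : nat :=
  \rank (tor_cycles i j) - \rank (tor_boundaries i j).

(* Each row of the Betti table has finite support. *)
Lemma tor_dim_supp (i : nat) (j : int) :
  j \notin codom (@fr_deg _ _ F i) -> tor_dim i j = 0%N.
Proof.
move=> nj; have t0 : tor_term i j = 0.
  apply/matrixP => s t; rewrite !mxE; case: eqP => [e|_]; last exact: mul0rn.
  by rewrite -e codom_f in nj.
rewrite /tor_dim; suff -> : \rank (tor_cycles i j) = 0%N by [].
case: i nj t0 => [|i] _ t0; rewrite /= t0; first exact: mxrank0.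
by rewrite cap0mx mxrank0.
Qed.

End Tor.

Definition table := nat -> {fsfun int -> rat with 0}.

Definition is_betti_table (k : fieldType) (M : gradedModule k) (v : table) :
    Prop :=
  exists F : freeResolution M, forall i j, v i j = (tor_dim F i j)%:R.

Definition cone (G : table -> Prop) (v : table) : Prop :=
  exists (n : nat) (c : 'I_n -> rat) (g : 'I_n -> table),
    [/\ forall s, 0 <= c s, forall s, G (g s)
      & forall i j, v i j = \sum_(s < n) c s * g s i j].

Definition betti_cone_fl (k : fieldType) : table -> Prop :=
  cone (fun v => exists2 M : gradedModule k,
    finite_length M & is_betti_table M v).

Variant degreeSequence :=
  | Deg0 of int
  | Deg1 (d0 d1 : int) of d0 < d1
  | DegInf (d0 d1 : int) of d0 < d1.

(* None stands for infinity. *)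
Definition deg_at (d : degreeSequence) (i : nat) : option int :=
  match d, i with
  | Deg0 d0, 0 => Some d0
  | Deg0 _, _ => None
  | Deg1 d0 _ _, 0 => Some d0
  | Deg1 _ d1 _, 1 => Some d1
  | Deg1 _ _ _, _ => None
  | DegInf d0 _ _, 0 => Some d0
  | DegInf _ d1 _, i'.+1 => Some (d1 + i'%:Z)
  end.

Definition pure_coef (d : degreeSequence) (i : nat) : rat :=
  match d, i with
  | DegInf _ _ _, i'.+1 => 3 * 2 ^+ i'
  | _, _ => 1
  end.

Definition pure_table (d : degreeSequence) : table := fun i =>
  if deg_at d i is Some e then [fsfun j in [fset e]%fset => pure_coef d i]
  else [fsfun].

Definition pure_cone_fl : table -> Prop :=
  cone (fun v => exists2 d : degreeSequence,
    deg_at d 1 <> None & v = pure_table d).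

Definition eps (i : nat) (j : int) (v : table) : rat := v i j.

Definition alpha (l : int) (v : table) : rat :=
  2 * eps 1 l v - eps 2 (l + 1) v.

Definition gamma_term (v : table) (j : int) : rat :=
  3 * eps 0 j v - 3 * eps 1 (j + 1) v + eps 2 (j + 2) v.

Definition gamma_supp (v : table) : {fset int} :=
  (finsupp (v 0%N) `|` [fset (j - 1)%R | j in finsupp (v 1%N)]
                 `|` [fset (j - 2)%R | j in finsupp (v 2%N)])%fset.

Lemma gamma_term_supp (v : table) (j : int) :
  j \notin gamma_supp v -> gamma_term v j = 0.
Proof.
rewrite !inE !negb_or => /andP[/andP[n0 n1] n2].
rewrite /gamma_term /eps (fsfun_dflt n0).
rewrite (fsfun_dflt (k := j + 1)); last first.
  by apply: contra n1 => h; apply/imfsetP; exists (j + 1); rewrite ?addrK.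
rewrite (fsfun_dflt (k := j + 2)); last first.
  by apply: contra n2 => h; apply/imfsetP; exists (j + 2); rewrite ?addrK.
by rewrite !mulr0 subr0 addr0.
Qed.

Definition gamma (l : int) (v : table) : rat :=
  \sum_(j <- gamma_supp v | j <= l) gamma_term v j.

Definition gamma_infty (v : table) : rat :=
  \sum_(j <- gamma_supp v) gamma_term v j.

Definition facet_cone_fl (v : table) : Prop :=
  (forall i j, 0 <= eps i j v) /\
  (forall l, 0 <= alpha l v) /\
  (forall l, 0 <= gamma l v) /\
  (forall i j, (2 <= i)%N -> 2 * eps i j v - eps i.+1 (j + 1) v = 0) /\
  gamma_infty v = 0.

(* Main.v *)
(* Restricting a free resolution F of M to the coordinate axes gives three
   complexes of free graded k[X]-modules.  Since the maximal ideal of B is the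
   direct sum of the three modules B/(y,z), B/(x,z), B/(x,y) shifted by one,
   Tor_(i+1)(M,k) is the sum of the i-th homologies of these complexes for
   i >= 1, while their positive homology is killed by X, so that the long exact
   sequence of multiplication by X breaks up.  Counting dimensions in each degree
   gives 2 beta_(i,j) = beta_(i+1,j+1) for i >= 2 and alpha_k >= 0, and makes
   gamma_k telescope to the difference between the sum of the Hilbert functions
   of the M/(y,z)M and three times that of M/(x,y,z)M; this is nonnegative, and
   vanishes in large degrees when M has finite length.

   Conversely, a table in F^f is determined by its first three rows, and
   decomposing it into the pi_d is a transport problem between the generators
   d_0 and the first syzygies d_1, for which the gamma_k >= 0 are exactly the
   solvability conditions.  Finally pi_d is the Betti table of
   B/(x^n + y^n + z^n) or of B/(x^n, y^n, z^n), with n = d_1 - d_0. *)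
Require Import Defs.
From HB Require Import structures.
From mathcomp Require Import all_boot all_order all_algebra finmap.
From mathcomp Require Import generic_quotient ring_quotient.
From mathcomp Require Import mpoly ring lra zify.

Set Implicit Arguments.
Unset Strict Implicit.
Unset Printing Implicit Defensive.

Import Order.TTheory GRing.Theory Num.Theory.

Local Open Scope ring_scope.
Local Open Scope quotient_scope.

(** * The ring B and its restrictions to the three coordinate axes *)

Section AxesRing.
Variable k : fieldType.
Local Notation B := (axesRing k).
Implicit Types (c : 'I_3) (b : B) (p : {mpoly k[3]}).

Lemma axes_proj_is_additive : zmod_morphism (@axes_proj k).
Proof. by move=> p q; rewrite /axes_proj !raddfB. Qed.

Lemma axes_proj_is_multiplicative : monoid_morphism (@axes_proj k).
Proof. by split=> [|p q]; rewrite /axes_proj ?rmorph1 ?rmorphM. Qed.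

HB.instance Definition _ :=
  GRing.isZmodMorphism.Build {mpoly k[3]} B (@axes_proj k) axes_proj_is_additive.
HB.instance Definition _ :=
  GRing.isMonoidMorphism.Build {mpoly k[3]} B (@axes_proj k)
    axes_proj_is_multiplicative.

Lemma axes_projP b : exists p, b = axes_proj p.
Proof. by exists (repr b); rewrite /axes_proj reprK. Qed.

Lemma axes_proj_eq0 p : axes_proj p = 0 <-> axes_ideal p.
Proof.
rewrite -(raddf0 (@axes_proj k)) /axes_proj -[axes_ideal p]/(p \in axes_idealr k).
by rewrite -[X in X \in _]subr0 Quotient.idealrBE; split=> /eqP.
Qed.

Definition axes_var c : B := axes_proj 'X_c.
Definition axes_const (a : k) : B := axes_proj a%:MP.
HB.instance Definition _ := GRing.RMorphism.copy axes_const
  (@axes_proj k \o @mpolyC 3 k).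

Definition axis_mpoly c : {mpoly k[3]} -> {poly k} :=
  mmap polyC (fun i => if i == c then 'X else 0).
HB.instance Definition _ c := GRing.RMorphism.on (axis_mpoly c).

Lemma axis_mpolyX c i : axis_mpoly c 'X_i = if i == c then 'X else 0.
Proof. by rewrite /axis_mpoly mmapX mmap1U. Qed.

Lemma ord3P (P : 'I_3 -> Prop) : P 0 -> P 1 -> P (1 *+ 2) -> forall c, P c.
Proof.
move=> P0 P1 P2 [[|[|[|m]]] lm] //.
- by rewrite (_ : Ordinal lm = 0) //; apply: val_inj.
- by rewrite (_ : Ordinal lm = 1) //; apply: val_inj.
- by rewrite (_ : Ordinal lm = 1 *+ 2) //; apply: val_inj.
Qed.

Lemma axis_mpoly_ideal c p : axes_ideal p -> axis_mpoly c p = 0.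
Proof.
move=> /axes_idealP[a [b [d ->]]]; rewrite !rmorphD !rmorphM /= !axis_mpolyX.
by elim/ord3P: c; rewrite /= !(mulr0, mul0r, addr0).
Qed.

(** The quotient map from B onto the coordinate ring k[X] of the axis [c]; [axis_proj] makes it
    independent of the representative. *)
Definition axis c b : {poly k} := axis_mpoly c (repr b).

Lemma axis_proj c p : axis c (axes_proj p) = axis_mpoly c p.
Proof.
apply/eqP; rewrite -subr_eq0 -rmorphB; apply/eqP/axis_mpoly_ideal.
by apply/axes_proj_eq0; rewrite rmorphB /= {1}/axes_proj reprK subrr.
Qed.

Lemma axis_is_additive c : zmod_morphism (axis c).
Proof.
move=> b b'; have [p ->] := axes_projP b; have [q ->] := axes_projP b'.
by rewrite -rmorphB !axis_proj rmorphB.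
Qed.

Lemma axis_is_multiplicative c : monoid_morphism (axis c).
Proof.
split=> [|b b']; first by rewrite -(rmorph1 (@axes_proj k)) axis_proj rmorph1.
have [p ->] := axes_projP b; have [q ->] := axes_projP b'.
by rewrite -rmorphM !axis_proj rmorphM.
Qed.

HB.instance Definition _ c :=
  GRing.isZmodMorphism.Build B {poly k} (axis c) (axis_is_additive c).
HB.instance Definition _ c :=
  GRing.isMonoidMorphism.Build B {poly k} (axis c) (axis_is_multiplicative c).

Lemma axis_var c i : axis c (axes_var i) = if i == c then 'X else 0.
Proof. by rewrite axis_proj axis_mpolyX. Qed.

Lemma axis_const c a : axis c (axes_const a) = a%:P.
Proof. by rewrite axis_proj /axis_mpoly mmapC. Qed.

(** All axes pass through the origin, where every monomial other than 1 vanishes. *)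
Lemma axes_res_axis c b : axes_res b = (axis c b)`_0.
Proof.
have [p ->] := axes_projP b; rewrite axes_res_proj axis_proj.
elim/mpolyind: p => [|a m p _ _ IH]; first by rewrite !raddf0 coef0.
rewrite mcoeffD rmorphD coefD /= IH; congr (_ + _).
rewrite mcoeffZ mcoeffX /axis_mpoly mmapZ mmapX coefCM; congr (_ * _).
have [->|] := eqVneq; first by rewrite mmap11 coef1.
rewrite -mdeg_eq0 mdegE => nz.
rewrite -horner_coef0 /mmap1 horner_prod; have /existsP [i mi] : [exists i, m i != 0%N].
  apply: contraR nz => /existsPn H.
  by rewrite big1 // => i _; apply/eqP; move: (H i); rewrite negbK.
rewrite (bigD1 i) //= horner_exp; case: eqP => _; rewrite ?hornerX ?hornerC expr0n.
  by rewrite (negbTE mi) mul0r.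
by rewrite (negbTE mi) mul0r.
Qed.

Lemma axis_coef0 c c' b : (axis c b)`_0 = (axis c' b)`_0.
Proof. by rewrite -!axes_res_axis. Qed.

Lemma axes_varM c c' : c != c' -> axes_var c * axes_var c' = 0.
Proof.
move=> ne; rewrite /axes_var -rmorphM /=; apply/axes_proj_eq0/axes_idealP.
elim/ord3P: c ne; elim/ord3P: c' => // _;
  by [exists 1, 0, 0; ring | exists 0, 1, 0; ring | exists 0, 0, 1; ring].
Qed.

Definition axis_lift c (q : {poly k}) : B := (map_poly axes_const q).[axes_var c].

HB.instance Definition _ c := GRing.RMorphism.copy (axis_lift c)
  (horner_eval (axes_var c) \o map_poly axes_const).

Lemma axis_liftX c : axis_lift c 'X = axes_var c.
Proof. by rewrite /axis_lift map_polyX hornerX. Qed.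

Lemma axis_liftC c a : axis_lift c a%:P = axes_const a.
Proof. by rewrite /axis_lift map_polyC hornerC. Qed.

(** Distinct variables annihilate each other, so only the constant term survives. *)
Lemma axes_var_lift c c' q :
  c != c' -> axes_var c * axis_lift c' q = axes_var c * axes_const q`_0.
Proof.
move=> ne; elim/poly_ind: q => [|q a IH]; first by rewrite coef0 !raddf0.
rewrite rmorphD rmorphM /= axis_liftX axis_liftC mulrDr mulrCA.
by rewrite axes_varM // mulr0 add0r coefD coefMX coefC /= add0r.
Qed.

(** The three lifts count the constant term three times, hence the correction. The right-hand side
    [E] is additive and compatible with constants, and the identity passes from [b] to [x_i * b], so
    it spreads from 1 to all monomials. *)
Lemma axes_decomp b :
  b = \sum_c axis_lift c (axis c b) - axes_const (axes_res b) *+ 2.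
Proof.
pose E b : B := \sum_c axis_lift c (axis c b) - axes_const (axes_res b) *+ 2.
have res0 b' : axes_res b' = (axis 0 b')`_0 by exact: axes_res_axis.
have ED b1 b2 : E (b1 + b2) = E b1 + E b2.
  rewrite /E !res0 !rmorphD /= coefD rmorphD /= mulrnDl opprD addrACA -big_split /=.
  by congr (_ + _); apply: eq_bigr => c _; rewrite !rmorphD.
have EZ a b1 : E (axes_const a * b1) = axes_const a * E b1.
  rewrite /E !res0 rmorphM /= axis_const coefCM rmorphM /= mulrBr mulrnAr mulr_sumr.
  congr (_ - _); apply: eq_bigr => c _.
  by rewrite !rmorphM /= axis_const axis_liftC.
have EX i b1 : E b1 = b1 -> E (axes_var i * b1) = axes_var i * b1.
  move=> Eb; rewrite -{2}Eb /E !res0 mulrBr mulr_sumr.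
  rewrite (bigD1 i) // [X in _ = X - _](bigD1 i) //=.
  rewrite big1 => [|c /negbTE ci]; last first.
    by rewrite !rmorphM /= axis_var eq_sym ci raddf0 mul0r.
  (* On the other two axes [x_i] sees only the constant term; these two copies cancel the
     correction. *)
  rewrite [X in _ = _ + X - _](eq_bigr (fun=> axes_var i * axes_const (axis 0 b1)`_0)); last first.
    by move=> c ci; rewrite axes_var_lift 1?eq_sym // (axis_coef0 c 0).
  rewrite sumr_const cardC1 card_ord mulrnAr addrK addr0.
  rewrite !rmorphM /= axis_var eqxx axis_liftX axis_var.
  by case: ifP => _; rewrite ?mul0r ?coefXM ?coef0 /= raddf0 mul0rn subr0.
have E1 : E 1 = 1.
  rewrite /E !res0 !rmorph1 coef1 /= !rmorph1.
  rewrite (eq_bigr (fun=> 1)) => [|c _]; last by rewrite !rmorph1.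
  by rewrite sumr_const card_ord -mulrnBr.
rewrite -/(E b); have [p ->] := axes_projP b.
elim/mpolyind: p => [|a m p _ _ IH].
  by rewrite raddf0; apply: (addIr (E 0)); rewrite -ED !addr0 add0r.
rewrite rmorphD ED -IH -mul_mpolyC rmorphM -/(axes_const a) EZ; congr (_ * _ + _).
rewrite mpolyXE_id rmorph_prod /=; elim/big_rec: _ => // i b' _ Eb'.
rewrite rmorphXn -/(axes_var i).
elim: (m i) => [|n IHn]; first by rewrite expr0 mul1r.
by rewrite exprS -mulrA EX.
Qed.

Lemma axis_inj b b' : (forall c, axis c b = axis c b') -> b = b'.
Proof.
move=> e; rewrite (axes_decomp b) (axes_decomp b') !(axes_res_axis 0) e.
by congr (_ - _); apply: eq_bigr => c _; rewrite e.
Qed.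

Lemma axis_lift_axis c c' q :
  axis c' (axis_lift c q) = if c == c' then q else (q`_0)%:P.
Proof.
elim/poly_ind: q => [|q a IH]; first by rewrite !raddf0 coef0 if_same.
rewrite !rmorphD !rmorphM /= axis_liftX axis_liftC axis_var axis_const IH.
by case: eqP => _ //; rewrite mulr0 add0r coefD coefMX coefC /= add0r.
Qed.

(** With [axis_inj], this identifies B with the triples of polynomials that agree at 0. The shared
    constant, counted three times by the lifts, is subtracted twice. *)
Lemma axis_surj (q : 'I_3 -> {poly k}) :
  (forall c c', (q c)`_0 = (q c')`_0) -> exists b, forall c, axis c b = q c.
Proof.
move=> q0; exists (\sum_c axis_lift c (q c) - axes_const (q 0)`_0 *+ 2) => c.
rewrite rmorphB rmorphMn /= axis_const rmorph_sum /= (bigD1 c) //=.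
rewrite axis_lift_axis eqxx (eq_bigr (fun=> ((q 0)`_0)%:P)) => [|c' /negbTE nc].
  by rewrite sumr_const cardC1 card_ord addrK.
by rewrite axis_lift_axis nc (q0 _ 0).
Qed.

(** Among the monomials of degree [n] only the pure power of [x_c] survives on the axis; evaluation
    at 1 reads off its coefficient. *)
Lemma axes_homog_axis c (n : nat) b :
  axes_homog n b -> axis c b = (axis c b).[1] *: 'X^n.
Proof.
move=> [p hp ->]; rewrite axis_proj.
suff [a ->] : exists a, axis_mpoly c p = a *: 'X^n.
  by rewrite hornerZ hornerXn expr1n mulr1.
rewrite /axis_mpoly /mmap; elim/big_ind: _ => [|q1 q2 [a1 ->] [a2 ->]|m _].
- by exists 0; rewrite scale0r.
- by exists (a1 + a2); rewrite scalerDl.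
have [e|ne] := eqVneq (mdeg m) n; last first.
  by exists 0; rewrite (dhomog_nemf_coeff hp ne) raddf0 mul0r scale0r.
have [mc|nc] := eqVneq (m c) n.
  exists p@_m; rewrite mul_polyC; congr (_ *: _).
  rewrite /mmap1 (bigD1 c) //= eqxx mc big1 ?mulr1 // => i ic.
  rewrite (_ : m i = 0)%N ?expr0 //; move: e.
  by rewrite mdegE (bigD1 c) //= mc (bigD1 i) //=; lia.
exists 0; rewrite /mmap1 scale0r; apply/eqP; rewrite mulf_eq0; apply/orP; right.
have [i ic mi] : exists2 i, i != c & m i != 0%N.
  apply/exists_inP; apply: contraR nc => /exists_inPn H.
  rewrite -e mdegE (bigD1 c) //= big1 ?addn0 // => i ic.
  by apply/eqP; move: (H i ic); rewrite negbK.
by rewrite (bigD1 i) //= (negbTE ic) expr0n (negbTE mi) mul0r.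
Qed.

End AxesRing.

(** * Row spaces, and triples of row vectors with one block per axis *)

Section RowSpaces.
Variable k : fieldType.

Lemma rank_eq_rV (m1 m2 n : nat) (A : 'M[k]_(m1, n)) (A' : 'M[k]_(m2, n)) :
  (forall u : 'rV_n, (u <= A)%MS = (u <= A')%MS) -> \rank A = \rank A'.
Proof.
move=> e; apply: eqmx_rank; apply/andP.
by split; apply/rV_subP => u; rewrite e.
Qed.

Lemma sub_mulmxP (m n p : nat) (A : 'M[k]_(m, n)) (C : 'M[k]_(n, p)) (u : 'rV_p) :
  reflect (exists2 a : 'rV_n, (a <= A)%MS & u = a *m C) (u <= A *m C)%MS.
Proof.
apply: (iffP submxP) => [[w ->]|[a /submxP[w ->] ->]].
  by exists (w *m A); rewrite ?submxMl ?mulmxA.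
by exists w; rewrite mulmxA.
Qed.

Definition row3 (n : nat) (a b c : 'rV[k]_n) : 'rV[k]_(n + (n + n)) :=
  row_mx a (row_mx b c).

Definition diag3 (m n : nat) (A B C : 'M[k]_(m, n)) :
    'M[k]_(m + (m + m), n + (n + n)) :=
  block_mx A 0 0 (block_mx B 0 0 C).

Lemma row3P (n : nat) (u : 'rV[k]_(n + (n + n))) : exists a b c, u = row3 a b c.
Proof.
exists (lsubmx u), (lsubmx (rsubmx u)), (rsubmx (rsubmx u)).
by rewrite /row3 !hsubmxK.
Qed.

Lemma row3_inj (n : nat) (a b c a' b' c' : 'rV[k]_n) :
  row3 a b c = row3 a' b' c' -> [/\ a = a', b = b' & c = c'].
Proof. by move=> /eq_row_mx[-> /eq_row_mx[-> ->]]. Qed.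

Lemma row3_diag3 (m n : nat) (a b c : 'rV[k]_m) (A B C : 'M[k]_(m, n)) :
  row3 a b c *m diag3 A B C = row3 (a *m A) (b *m B) (c *m C).
Proof. by rewrite /row3 /diag3 !mul_row_block !mulmx0 !addr0 !add0r. Qed.

Lemma row3_sub_diag3 (m n : nat) (a b c : 'rV[k]_n) (A B C : 'M[k]_(m, n)) :
  (row3 a b c <= diag3 A B C)%MS = [&& a <= A, b <= B & c <= C]%MS.
Proof.
apply/submxP/and3P => [[w]|[/submxP[x ->] /submxP[y ->] /submxP[z ->]]].
  have [x [y [z ->]]] := row3P w; rewrite row3_diag3 => /row3_inj[-> -> ->].
  by rewrite !submxMl.
by exists (row3 x y z); rewrite row3_diag3.
Qed.

Lemma rank_diag3 (m n : nat) (A B C : 'M[k]_(m, n)) :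
  \rank (diag3 A B C) = (\rank A + (\rank B + \rank C))%N.
Proof. by rewrite /diag3 !rank_diag_block_mx. Qed.

Lemma diag3M (m n p : nat) (A B C : 'M[k]_(m, n)) (A' B' C' : 'M[k]_(n, p)) :
  diag3 A B C *m diag3 A' B' C' = diag3 (A *m A') (B *m B') (C *m C').
Proof.
by rewrite /diag3 !mulmx_block !(mulmx0, mul0mx, addr0, add0r).
Qed.

End RowSpaces.

(** * Rank identities for a complex restricted to the axes *)

(* A complex of graded free modules over B, seen through its restrictions
   [D c] to the three axes (dehomogenized, so that the degree [j] strand of the
   restriction is the part of filtration degree at most [j]) and its reduction
   [D0] to the residue field. *)
Section Strands.
Variables (k : fieldType) (r : nat -> nat) (deg : forall i, 'I_(r i) -> int).
Variables (D : 'I_3 -> forall i, 'M[k]_(r i.+1, r i)).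
Variable (D0 : forall i, 'M[k]_(r i.+1, r i)).
Arguments deg {i}.
Implicit Types (c : 'I_3) (i : nat) (j : int).
Hypothesis D_filtered : forall c i s t, D c i s t != 0 -> deg t <= deg s.
Hypothesis D0E : forall c i s t,
  D0 i s t = if deg s == deg t then D c i s t else 0.
Hypothesis D_complex : forall c i, D c i.+1 *m D c i = 0.

(** Projectors used through their row spaces. In degree [j] the restriction to an axis has one
    monomial X^(j - deg s) for each [deg s <= j], and it is divisible by X when [deg s < j]. So
    [deg_lt i (j + 1)] is the full strand of degree [j], [deg_lt i j] its part divisible by X, and
    [deg_eq i j] the quotient. *)
Definition deg_lt i (j : int) : 'M[k]_(r i) := diag_mx (\row_s (deg s < j)%R%:R).
Definition deg_eq i (j : int) : 'M[k]_(r i) := diag_mx (\row_s (deg s == j)%:R).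

Lemma sub_deg_lt i j (u : 'rV_(r i)) :
  reflect (forall s, j <= deg s -> u 0 s = 0) (u <= deg_lt i j)%MS.
Proof.
apply: (iffP submxP) => [[w ->] s js|u0].
  by rewrite mul_mx_diag !mxE ltNge js mulr0.
exists u; apply/rowP => s; rewrite mul_mx_diag !mxE.
by case: ltP => [_|/u0->]; rewrite ?mulr1 ?mul0r.
Qed.

Lemma sub_deg_eq i j (u : 'rV_(r i)) :
  reflect (forall s, deg s != j -> u 0 s = 0) (u <= deg_eq i j)%MS.
Proof.
apply: (iffP submxP) => [[w ->] s /negbTE js|u0].
  by rewrite mul_mx_diag !mxE js mulr0.
exists u; apply/rowP => s; rewrite mul_mx_diag !mxE.
by case: eqVneq => [_|/u0->]; rewrite ?mulr1 ?mul0r.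
Qed.

Lemma mul_deg_eqE i j (u : 'rV_(r i)) s :
  (u *m deg_eq i j) 0 s = if deg s == j then u 0 s else 0.
Proof. by rewrite mul_mx_diag !mxE; case: eqP => _; rewrite ?mulr1 ?mulr0. Qed.

Lemma sub_ker_deg_eq i j (u : 'rV_(r i)) :
  reflect (forall s, deg s = j -> u 0 s = 0) (u <= kermx (deg_eq i j))%MS.
Proof.
apply: (iffP sub_kermxP) => [/rowP u0 s sj|u0].
  by have := u0 s; rewrite mul_deg_eqE sj eqxx mxE.
by apply/rowP => s; rewrite mul_deg_eqE mxE; case: eqP => // /u0.
Qed.

Lemma deg_lt_succ i j (u : 'rV_(r i)) :
  (u <= deg_lt i j)%MS =
  (u <= deg_lt i (j + 1))%MS && (u <= kermx (deg_eq i j))%MS.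
Proof.
apply/sub_deg_lt/andP => [u0|[/sub_deg_lt u0 /sub_ker_deg_eq u1] s].
  split; first by apply/sub_deg_lt => s h; apply: u0; lia.
  by apply/sub_ker_deg_eq => s h; apply: u0; lia.
by rewrite le_eqVlt => /orP[/eqP/esym/u1//|h]; apply: u0; lia.
Qed.

Lemma deg_eq_lt i j (u : 'rV_(r i)) :
  (u <= deg_eq i j)%MS -> (u <= deg_lt i (j + 1))%MS.
Proof. by move/sub_deg_eq => u0; apply/sub_deg_lt => s js; apply: u0; lia. Qed.

Lemma rank_deg_lt_succ i j :
  \rank (deg_lt i (j + 1)) = (\rank (deg_lt i j) + \rank (deg_eq i j))%N.
Proof.
rewrite -(mxrank_mul_ker _ (deg_eq i j)) addnC; congr (_ + _)%N.
  by apply: rank_eq_rV => u; rewrite sub_capmx -deg_lt_succ.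
congr (\rank _); apply/matrixP => s t; rewrite mul_mx_diag !mxE.
case: (eqVneq s t) => [->|_]; rewrite ?mulr1n ?mulr0n ?mul0r //.
by case: (eqVneq (deg t) j) => [->|]; rewrite ?mulr0 // mulr1 ltzD1 lexx.
Qed.

Lemma sub_deg_ltD c i j (u : 'rV_(r i.+1)) :
  (u <= deg_lt i.+1 j)%MS -> (u *m D c i <= deg_lt i j)%MS.
Proof.
move/sub_deg_lt => u0; apply/sub_deg_lt => t jt; rewrite mxE big1 // => s _.
have [->|/D_filtered ts] := eqVneq (D c i s t) 0; first by rewrite mulr0.
by rewrite u0 ?mul0r // (le_trans jt).
Qed.

(** Reduction modulo X commutes with the differential: since [D] is filtered, a column of degree [j]
    can only meet rows of degree at least [j], and in degree [j] itself [D] is [D0]. *)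
Lemma deg_ltD_eq c i j :
  deg_lt i.+1 (j + 1) *m D c i *m deg_eq i j = deg_eq i.+1 j *m D0 i.
Proof.
apply/matrixP => s t; rewrite mul_mx_diag !mul_diag_mx !mxE (D0E c).
case: (eqVneq (deg t) j) => [<-|tj]; rewrite ?mulr1 ?mulr0.
  case: (eqVneq (deg s) (deg t)) => [->|ne]; first by rewrite ltzD1 lexx.
  rewrite mulr0; have [->|/D_filtered ts] := eqVneq (D c i s t) 0.
    by rewrite mulr0.
  by rewrite (_ : _ < _ = false) ?mul0r //; lia.
case: (eqVneq (deg s) j) => [sj|_]; rewrite ?mul0r //.
by rewrite sj eq_sym (negbTE tj) mulr0.
Qed.

Lemma deg_ltD_eq_row c i j (u : 'rV_(r i.+1)) :
  (u <= deg_lt i.+1 (j + 1))%MS ->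
  u *m D c i *m deg_eq i j = u *m deg_eq i.+1 j *m D0 i.
Proof.
move=> /submxP[w ->]; rewrite -!mulmxA [deg_lt _ _ *m (_ *m _)]mulmxA.
rewrite deg_ltD_eq; congr (_ *m _); rewrite mulmxA; congr (_ *m _).
rewrite /deg_lt /deg_eq mulmx_diag; congr diag_mx; apply/rowP => s; rewrite !mxE.
by case: eqVneq => [->|_]; rewrite ?mulr0 // ltzD1 lexx mulr1.
Qed.

(** When the outer degrees agree, the filtration forces every nonzero term of the product of the
    [D]'s through an index of the same degree, where [D] and [D0] coincide. *)
Lemma D0_complex i : D0 i.+1 *m D0 i = 0.
Proof.
apply/matrixP => s t; rewrite !mxE.
have /matrixP/(_ s t) := D_complex 0 i; rewrite !mxE.
case: (eqVneq (deg s) (deg t)) => [st H|st _]; last first.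
  apply: big1 => m _; rewrite !(D0E 0).
  case: eqP => [sm|_]; last by rewrite mul0r.
  by rewrite -sm (negbTE st) mulr0.
rewrite -[RHS]H; apply: eq_bigr => m _; rewrite !(D0E 0).
case: (eqVneq (D 0 i.+1 s m) 0) => [->|/D_filtered ms].
  by rewrite if_same !mul0r.
case: (eqVneq (D 0 i m t) 0) => [->|/D_filtered tm]; first by rewrite if_same !mulr0.
have sm : deg s = deg m by lia.
by rewrite -sm st !eqxx.
Qed.

Local Notation n i j := (\rank (deg_lt i j)).
Local Notation e i j := (\rank (deg_eq i j)).
Definition axis_rank c i j := \rank (deg_lt i.+1 j *m D c i).
Definition res_rank i j := \rank (deg_eq i.+1 j *m D0 i).

Lemma axis_rank_split c i j :
  axis_rank c i (j + 1) = (res_rank i j +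
    \rank (deg_lt i.+1 (j + 1) *m D c i :&: kermx (deg_eq i j))%MS)%N.
Proof. by rewrite /axis_rank -(mxrank_mul_ker _ (deg_eq i j)) deg_ltD_eq. Qed.

Lemma axis_rank_le c i j : (axis_rank c i j <= n i j)%N.
Proof.
apply/mxrankS/rV_subP => u /sub_mulmxP[a ha ->]; exact: sub_deg_ltD.
Qed.

Lemma axis_rank_res_le c i j : (axis_rank c i (j + 1) <= res_rank i j + n i j)%N.
Proof.
rewrite axis_rank_split leq_add2l; apply/mxrankS/rV_subP => u.
rewrite deg_lt_succ sub_capmx => /andP[/sub_mulmxP[a ha ->] ->].
by rewrite sub_deg_ltD.
Qed.

Lemma res_rank_le_eq i j : (res_rank i j <= e i j)%N.
Proof. by rewrite /res_rank -(deg_ltD_eq 0) mxrankM_maxr. Qed.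

Lemma boundaries_sub i j :
  (deg_eq i.+2 j *m D0 i.+1 <= deg_eq i.+1 j :&: kermx (D0 i))%MS.
Proof.
rewrite sub_capmx -{1}(deg_ltD_eq 0) submxMl; apply/sub_kermxP.
by rewrite -mulmxA D0_complex mulmx0.
Qed.

Definition diff3 i := diag3 (D 0 i) (D 1 i) (D (1 *+ 2) i).

(* The degree [j] strand of the free module: triples of elements on the axes
   which agree at the origin. *)
Definition strand i j : 'M[k]_(r i + (r i + r i)) :=
  (diag3 (deg_lt i (j + 1)) (deg_lt i (j + 1)) (deg_lt i (j + 1)) :&:
   kermx (col_mx (row_mx (deg_eq i j) (deg_eq i j))
     (col_mx (row_mx (- deg_eq i j) 0) (row_mx 0 (- deg_eq i j)))))%MS.

(** The value at the origin is common to the three components of a strand, so it is read off the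
    first. *)
Definition strand_origin i j : 'M[k]_(r i + (r i + r i), r i) :=
  col_mx (deg_eq i j) 0.

Definition strand_rank i j := \rank (strand i.+1 j *m diff3 i).

Lemma row3_origin i j (a b c : 'rV_(r i)) :
  row3 a b c *m strand_origin i j = a *m deg_eq i j.
Proof. by rewrite /row3 mul_row_col mulmx0 addr0. Qed.

Lemma row3_sub_strand i j (a b c : 'rV_(r i)) :
  reflect [/\ [/\ a <= deg_lt i (j + 1), b <= deg_lt i (j + 1)
                & c <= deg_lt i (j + 1)]%MS,
              a *m deg_eq i j = b *m deg_eq i j
            & a *m deg_eq i j = c *m deg_eq i j]
    (row3 a b c <= strand i j)%MS.
Proof.
rewrite sub_capmx row3_sub_diag3.
set Q := col_mx _ _.
have -> : (row3 a b c <= kermx Q)%MS =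
  (a *m deg_eq i j == b *m deg_eq i j) && (a *m deg_eq i j == c *m deg_eq i j).
  apply/sub_kermxP/andP; rewrite /Q /row3 !mul_row_col !mul_mx_row add_row_mx.
    rewrite !mulmx0 addr0 add0r !mulmxN add_row_mx -[0]row_mx0.
    by move=> /eq_row_mx[/eqP + /eqP +]; rewrite !subr_eq0.
  move=> [/eqP ab /eqP ac]; rewrite !mulmx0 addr0 add0r !mulmxN add_row_mx.
  by rewrite -ab -ac !subrr row_mx0.
apply: (iffP andP) => [[/and3P[-> -> ->] /andP[/eqP-> /eqP->]]|[[-> -> ->] -> ->]] //.
by rewrite !eqxx.
Qed.

(** Once the values at the origin are zero the agreement conditions are void: the maximal ideal is
    the direct sum of its parts along the axes. *)
Lemma strand_cap_origin i j (u : 'rV_(r i + (r i + r i))) :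
  (u <= strand i j :&: kermx (strand_origin i j))%MS =
  (u <= diag3 (deg_lt i j) (deg_lt i j) (deg_lt i j))%MS.
Proof.
have [a [b [c ->]]] := row3P u; rewrite sub_capmx row3_sub_diag3.
rewrite (deg_lt_succ j a) (deg_lt_succ j b) (deg_lt_succ j c).
apply/andP/and3P => [[/row3_sub_strand[[-> -> ->] ab ac] /sub_kermxP]|].
  rewrite row3_origin => a0; split; apply/sub_kermxP => //.
    by rewrite -ab.
  by rewrite -ac.
move=> [/andP[ha /sub_kermxP a0] /andP[hb /sub_kermxP b0] /andP[hc /sub_kermxP c0]].
split; first by apply/row3_sub_strand; rewrite ha hb hc a0 b0 c0.
by apply/sub_kermxP; rewrite row3_origin.
Qed.

(** Each basis vector contributes according to the Hilbert function 1, 3, 3, ... of B. *)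
Lemma rank_strand i j : \rank (strand i j) = (3 * n i j + e i j)%N.
Proof.
rewrite -(mxrank_mul_ker _ (strand_origin i j)) addnC; congr (_ + _)%N.
  rewrite (rank_eq_rV (@strand_cap_origin i j)) rank_diag3; lia.
apply: rank_eq_rV => u; apply/sub_mulmxP/idP => [[w + ->]|hu].
  have [a [b [c ->]]] := row3P w => _; rewrite row3_origin; exact: submxMl.
exists (row3 u u u).
  by apply/row3_sub_strand; rewrite deg_eq_lt.
rewrite row3_origin; apply/rowP => s; rewrite mul_deg_eqE.
by case: eqP => // /eqP; move/sub_deg_eq: hu => h /h.
Qed.

Lemma strand_rank_split i j :
  strand_rank i j = (res_rank i j +
    \rank (strand i.+1 j *m diff3 i :&: kermx (strand_origin i j))%MS)%N.
Proof.
rewrite /strand_rank -(mxrank_mul_ker _ (strand_origin i j)); congr (_ + _)%N.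
apply: rank_eq_rV => u; rewrite -mulmxA; apply/sub_mulmxP/sub_mulmxP => [[w + ->]|].
  have [a [b [c ->]]] := row3P w => /row3_sub_strand[[ha _ _] _ _].
  exists (a *m deg_eq i.+1 j); first exact: submxMl.
  by rewrite mulmxA row3_diag3 row3_origin deg_ltD_eq_row.
move=> [a ha ->]; exists (row3 a a a); first by apply/row3_sub_strand; rewrite deg_eq_lt.
rewrite mulmxA row3_diag3 row3_origin deg_ltD_eq_row ?deg_eq_lt //; congr (_ *m _).
apply/rowP => s; rewrite mul_deg_eqE.
by case: eqP => // /eqP; move/sub_deg_eq: ha => h /h.
Qed.

(** Both sides are split by the value at the origin. The three axes count [res_rank] three times and
    the strand once; a boundary that vanishes at the origin restricts to such a boundary on every
    axis. *)
Lemma strand_rank_le i j :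
  (strand_rank i j + 2 * res_rank i j <= axis_rank 0%R i (j + 1)
   + axis_rank 1%R i (j + 1) + axis_rank (1 *+ 2)%R i (j + 1))%N.
Proof.
rewrite strand_rank_split !axis_rank_split.
pose K c := (deg_lt i.+1 (j + 1) *m D c i :&: kermx (deg_eq i j))%MS.
suff : (\rank (strand i.+1 j *m diff3 i :&: kermx (strand_origin i j))%MS <=
        \rank (diag3 (K 0%R) (K 1%R) (K (1 *+ 2)%R)))%N.
  by rewrite rank_diag3 /K; lia.
apply/mxrankS/rV_subP => u; rewrite sub_capmx.
move=> /andP[/sub_mulmxP[w + ->]].
have [a [b [c ->]]] := row3P w; rewrite row3_diag3.
move=> /row3_sub_strand[[ha hb hc] ab ac] /sub_kermxP; rewrite row3_origin => a0.
rewrite row3_sub_diag3 !sub_capmx !submxMr //=; apply/and3P; split; apply/sub_kermxP => //.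
  by rewrite deg_ltD_eq_row // -ab -(deg_ltD_eq_row 0).
by rewrite deg_ltD_eq_row // -ac -(deg_ltD_eq_row 0).
Qed.

(** Exactness of the complex over B, expressed on the compatible triples that represent its elements
    of degree [j]. *)
Hypothesis D_exact : forall i j (a : 'I_3 -> 'rV[k]_(r i.+1)),
  (forall c, a c <= deg_lt i.+1 (j + 1))%MS ->
  (forall c c', a c *m deg_eq i.+1 j = a c' *m deg_eq i.+1 j) ->
  (forall c, a c *m D c i = 0) ->
  exists b : 'I_3 -> 'rV[k]_(r i.+2),
    [/\ forall c, (b c <= deg_lt i.+2 (j + 1))%MS,
        forall c c', b c *m deg_eq i.+2 j = b c' *m deg_eq i.+2 j
      & forall c, a c = b c *m D c i.+1].

(* The variable of an axis kills the positive homology of the restriction to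
   that axis. *)
Lemma axis_rank_rec c i j :
  (axis_rank c i.+1 (j + 1) + axis_rank c i j = res_rank i.+1 j + n i.+1 j)%N.
Proof.
rewrite axis_rank_split -addnA; congr (_ + _)%N.
rewrite -(mxrank_mul_ker (deg_lt i.+1 j) (D c i)) addnC; congr (_ + _)%N.
apply: rank_eq_rV => u; rewrite !sub_capmx; apply/andP/andP.
  move=> [/sub_mulmxP[a ha ->] h]; rewrite deg_lt_succ h.
  rewrite sub_deg_ltD //; split => //; apply/sub_kermxP.
  by rewrite -mulmxA D_complex mulmx0.
move=> [hu /sub_kermxP uD].
have := hu; rewrite deg_lt_succ => /andP[hu1 hu2]; split=> //.
(* A cycle divisible by X on one axis, extended by zero to the other two, is a cycle over B; the
   preimage given by exactness is then restricted to that axis. *)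
have [|||b [hb _ eb]] := @D_exact i j (fun c' => if c' == c then u else 0).
- by move=> c'; case: eqP => _ //; rewrite sub0mx.
- have E c' : (if c' == c then u else 0) *m deg_eq i.+1 j = 0.
    by case: eqP => _; rewrite ?mul0mx //; apply/sub_kermxP.
  by move=> c1 c2; rewrite !E.
- by move=> c'; case: eqP => [->|_]; rewrite ?mul0mx.
by apply/sub_mulmxP; exists (b c) => //; have := eb c; rewrite eqxx.
Qed.

Lemma strand_exact i j (u : 'rV_(r i.+1 + (r i.+1 + r i.+1))) :
  (u <= strand i.+2 j *m diff3 i.+1)%MS =
  (u <= strand i.+1 j :&: kermx (diff3 i))%MS.
Proof.
rewrite sub_capmx; apply/sub_mulmxP/andP => [[w + ->]|].
  have [a [b [c ->]]] := row3P w; rewrite row3_diag3.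
  move=> /row3_sub_strand[[ha hb hc] ab ac]; split; last first.
    apply/sub_kermxP; rewrite row3_diag3 -!mulmxA !D_complex !mulmx0.
    by rewrite /row3 !row_mx0.
  apply/row3_sub_strand; rewrite !sub_deg_ltD //.
  by rewrite !deg_ltD_eq_row // -ab -ac.
have [a0 [a1 [a2 ->]]] := row3P u => -[/row3_sub_strand[[h0 h1 h2] h01 h02]].
move=> /sub_kermxP; rewrite row3_diag3 [RHS](_ : _ = row3 0 0 0); last by rewrite /row3 !row_mx0.
move=> /row3_inj[d0 d1 d2].
pose a (c : 'I_3) := if c == 0 then a0 else if c == 1 then a1 else a2.
have [|||b [hb bb eb]] := @D_exact i j a.
- by elim/ord3P.
- have E c : a c *m deg_eq i.+1 j = a0 *m deg_eq i.+1 j by elim/ord3P: c.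
  by move=> c1 c2; rewrite !E.
- by elim/ord3P.
exists (row3 (b 0) (b 1) (b (1 *+ 2))).
  by apply/row3_sub_strand; split; [split|exact: bb|exact: bb].
by rewrite row3_diag3 -!eb.
Qed.

Lemma strand_rank_rec i j :
  (strand_rank i.+1 j + strand_rank i j = 3 * n i.+1 j + e i.+1 j)%N.
Proof.
rewrite -rank_strand -(mxrank_mul_ker _ (diff3 i)) addnC; congr (_ + _)%N.
exact: rank_eq_rV (@strand_exact i j).
Qed.

(** By exactness, boundaries that vanish at the origin are cycles that vanish there, that is,
    arbitrary triples of axis cycles divisible by X; rank-nullity on each axis counts these. *)
Lemma strand_axis_rank i j :
  (strand_rank i.+1 j + (axis_rank 0%R i j + axis_rank 1%R i j
    + axis_rank (1 *+ 2)%R i j) = res_rank i.+1 j + 3 * n i.+1 j)%N.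
Proof.
rewrite strand_rank_split -addnA; congr (_ + _)%N.
have := mxrank_mul_ker (diag3 (deg_lt i.+1 j) (deg_lt i.+1 j) (deg_lt i.+1 j)) (diff3 i).
rewrite diag3M !rank_diag3 -!/(axis_rank _ _ _).
suff -> : \rank (strand i.+2 j *m diff3 i.+1 :&: kermx (strand_origin i.+1 j))%MS
   = \rank (diag3 (deg_lt i.+1 j) (deg_lt i.+1 j) (deg_lt i.+1 j) :&: kermx (diff3 i))%MS.
  by rewrite /axis_rank; lia.
apply: rank_eq_rV => u; rewrite sub_capmx strand_exact [RHS]sub_capmx.
by rewrite -strand_cap_origin (sub_capmx u (strand _ _)) sub_capmx andbAC.
Qed.

End Strands.

(** * Relations between the Betti numbers of a free resolution *)

Section Betti.
Variables (k : fieldType) (M : gradedModule k) (F : freeResolution M).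
Local Notation B := (axesRing k).
Local Notation r := (fr_rank F).
Local Notation deg := (@fr_deg _ _ F _).
Implicit Types (c : 'I_3) (j : int).

(** Setting X to 1 loses nothing: each entry is a monomial whose exponent is dictated by the
    degrees, as [axis_diffE] records. *)
Definition axis_diff c i : 'M[k]_(r i.+1, r i) :=
  map_mx (horner_eval 1 \o axis c) (fr_diff F i).

Lemma axis_diff_neg c i s t : deg s < deg t -> axis c (fr_diff F i s t) = 0.
Proof.
move=> st; have := fr_diff_homog (f := F) s t.
have -> : deg s - deg t = Negz (`|deg t - deg s|.-1)%N by lia.
by move=> ->; rewrite rmorph0.
Qed.

Lemma axis_diffE c i s t : deg t <= deg s ->
  axis c (fr_diff F i s t) = axis_diff c i s t *: 'X^(`|deg s - deg t|).
Proof.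
move=> ts; rewrite mxE /=; apply: axes_homog_axis.
by have := fr_diff_homog (f := F) s t; rewrite gez0_abs ?subr_ge0.
Qed.

Lemma axis_diff_filtered c i s t : axis_diff c i s t != 0 -> deg t <= deg s.
Proof.
apply: contraR; rewrite -ltNge => st.
by rewrite mxE /= axis_diff_neg // /horner_eval horner0.
Qed.

Lemma axis_diff0 c i s t :
  axis_diff c i s t = 0 -> axis c (fr_diff F i s t) = 0.
Proof.
case: (leP (deg t) (deg s)) => [ts D0|st _]; last exact: axis_diff_neg.
by rewrite axis_diffE // D0 scale0r.
Qed.

Lemma tor_diffE c i s t :
  tor_diff F i s t = if deg s == deg t then axis_diff c i s t else 0.
Proof.
rewrite mxE (axes_res_axis c); case: (ltgtP (deg s) (deg t)) => st.
- by rewrite axis_diff_neg // coef0.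
- rewrite axis_diffE ?ltW // coefZ coefXn (_ : 0%N == _ = false) ?mulr0 //; lia.
- by rewrite axis_diffE ?st // subrr coefZ coefXn mulr1.
Qed.

Lemma fr_diff_complex i : fr_diff F i.+1 *m fr_diff F i = 0.
Proof.
apply/row_matrixP => s; rewrite row_mul row0; apply/fr_exact.
by exists (delta_mx 0 s); rewrite -rowE.
Qed.

Lemma axis_diff_complex c i : axis_diff c i.+1 *m axis_diff c i = 0.
Proof. by rewrite -map_mxM fr_diff_complex map_mx0. Qed.

(** The part of degree [j] of a vector that need not be homogeneous, restricted to an axis and
    dehomogenized. *)
Definition axis_strand c j i (u : 'rV[B]_(r i)) : 'rV[k]_(r i) :=
  \row_s (if deg s <= j then (axis c (u 0 s))`_(`|j - deg s|) else 0).

Lemma axis_strand_mul c j i (w : 'rV[B]_(r i.+1)) :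
  axis_strand c j (w *m fr_diff F i) = axis_strand c j w *m axis_diff c i.
Proof.
apply/rowP => t; rewrite !mxE rmorph_sum /=.
have -> : (if deg t <= j then
    (\sum_s axis c (w 0 s * fr_diff F i s t))`_(`|j - deg t|) else 0) =
  \sum_s (if deg t <= j then (axis c (w 0 s * fr_diff F i s t))`_(`|j - deg t|) else 0).
  by case: leP => _; rewrite ?coef_sum // big1.
apply: eq_bigr => s _; rewrite [X in _ = X * _]mxE rmorphM /=.
have [D0|nz] := eqVneq (axis_diff c i s t) 0.
  by rewrite D0 axis_diff0 // !mulr0 coef0 if_same.
have ts := axis_diff_filtered nz.
rewrite axis_diffE // -scalerAr coefZ coefMXn mulrC.
case: (leP (deg t) j) => tj; last by rewrite [deg s <= j]leNgt (lt_le_trans tj ts) mul0r.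
case: (leP (deg s) j) => sj.
  rewrite ifF; last by lia.
  by congr (_`_ _ * _); lia.
by rewrite ifT ?mul0r //; lia.
Qed.

Lemma axis_strand_lt c j i (u : 'rV[B]_(r i)) :
  (axis_strand c j u <= deg_lt k (@fr_deg _ _ F) i (j + 1))%MS.
Proof. by apply/sub_deg_lt => s js; rewrite mxE ifF //; lia. Qed.

Lemma axis_strand_origin c c' j i (u : 'rV[B]_(r i)) :
  axis_strand c j u *m deg_eq k (@fr_deg _ _ F) i j =
  axis_strand c' j u *m deg_eq k (@fr_deg _ _ F) i j.
Proof.
apply/rowP => s; rewrite !mul_deg_eqE !mxE; case: eqP => // ->.
by rewrite lexx subrr (axis_coef0 c c').
Qed.

(** The triple is homogenized and glued to a vector over B by [axis_surj]; a preimage under the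
    resolution is then cut down to its part of degree [j]. *)
Lemma axis_strand_exact i j (a : 'I_3 -> 'rV[k]_(r i.+1)) :
  (forall c, a c <= deg_lt k (@fr_deg _ _ F) i.+1 (j + 1))%MS ->
  (forall c c', a c *m deg_eq k (@fr_deg _ _ F) i.+1 j
                = a c' *m deg_eq k (@fr_deg _ _ F) i.+1 j) ->
  (forall c, a c *m axis_diff c i = 0) ->
  exists b : 'I_3 -> 'rV[k]_(r i.+2),
    [/\ forall c, (b c <= deg_lt k (@fr_deg _ _ F) i.+2 (j + 1))%MS,
        forall c c', b c *m deg_eq k (@fr_deg _ _ F) i.+2 j
                     = b c' *m deg_eq k (@fr_deg _ _ F) i.+2 j
      & forall c, a c = b c *m axis_diff c i.+1].
Proof.
move=> alt aeq aD.
have a0 c s : j < deg s -> a c 0 s = 0.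
  by move=> js; move/sub_deg_lt: (alt c); apply; lia.
have /fin_all_exists[u uE] s : exists b : B, forall c,
    axis c b = a c 0 s *: 'X^(`|j - deg s|).
  apply: axis_surj => c c'; rewrite !coefZ !coefXn.
  have [sj|ne] := eqVneq (deg s) j; last first.
    have [/a0 h|sj] := ltP j (deg s); first by rewrite !h !mul0r.
    by rewrite (_ : 0%N == _ = false) ?mulr0 //; lia.
  by have /rowP/(_ s) := aeq c c'; rewrite !mul_deg_eqE sj eqxx => ->.
have ud : (\row_s u s) *m fr_diff F i = 0.
  apply/rowP => t; apply: axis_inj => c; rewrite !mxE rmorph0 rmorph_sum /=.
  have /rowP/(_ t) := aD c; rewrite !mxE => aDt.
  transitivity ((\sum_s a c 0 s * axis_diff c i s t) *: 'X^(`|j - deg t|) : {poly k}).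
    rewrite scaler_suml; apply: eq_bigr => s _; rewrite mxE rmorphM /= uE.
    have [D0|nz] := eqVneq (axis_diff c i s t) 0.
      by rewrite D0 axis_diff0 // !mulr0 scale0r.
    have ts := axis_diff_filtered nz; rewrite axis_diffE //.
    have [/a0 ->|sj] := ltP j (deg s); first by rewrite !mul0r !scale0r mul0r.
    rewrite -scalerAl -scalerAr scalerA -exprD; congr (_ *: 'X^ _); lia.
  by rewrite aDt scale0r.
have [w uw] := (fr_exact (\row_s u s)).1 ud.
exists (fun c => axis_strand c j w); split=> [c|c c'|c].
- exact: axis_strand_lt.
- exact: axis_strand_origin.
rewrite -axis_strand_mul -uw; apply/rowP => s; rewrite !mxE uE.
have [/a0 ->|sj] := ltP j (deg s); first by rewrite ?if_same //.
by rewrite coefZ coefXn eqxx mulr1.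
Qed.

Local Notation n i j := (\rank (deg_lt k (@fr_deg _ _ F) i j)).
Local Notation e i j := (\rank (deg_eq k (@fr_deg _ _ F) i j)).
Local Notation R c i j := (axis_rank (@fr_deg _ _ F) axis_diff c i j).
Local Notation R0 i j := (res_rank (@fr_deg _ _ F) (tor_diff F) i j).
Local Notation RF i j := (strand_rank (@fr_deg _ _ F) axis_diff i j).

Lemma tor_dim0E j : (tor_dim F 0 j + R0 0 j)%N = e 0 j.
Proof.
rewrite /tor_dim /= -/(deg_eq k (@fr_deg _ _ F) 0 j) subnK //.
exact: (res_rank_le_eq axis_diff_filtered tor_diffE).
Qed.

Lemma tor_dimSE i j : (tor_dim F i.+1 j + R0 i j + R0 i.+1 j)%N = e i.+1 j.
Proof.
have := mxrank_mul_ker (deg_eq k (@fr_deg _ _ F) i.+1 j) (tor_diff F i).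
have := mxrankS (boundaries_sub axis_diff_filtered tor_diffE axis_diff_complex i j).
rewrite /tor_dim /tor_cycles /tor_boundaries /res_rank /deg_eq /tor_term; lia.
Qed.

Let axis_rec := axis_rank_rec axis_diff_filtered tor_diffE axis_diff_complex
  axis_strand_exact.
Let strand_rec := strand_rank_rec axis_diff_filtered tor_diffE axis_diff_complex
  axis_strand_exact.
Let strand_axis := strand_axis_rank axis_diff_filtered tor_diffE axis_diff_complex
  axis_strand_exact.
Let n_succ i j : n i (j + 1) = (n i j + e i j)%N := rank_deg_lt_succ _ _ i j.

(** Eliminating the ranks between the recursions on the axes and on the strands leaves only Betti
    numbers. *)
Lemma tor_dim_double i j : tor_dim F i.+3 (j + 1) = (2 * tor_dim F i.+2 j)%N.
Proof.
have h c := conj (axis_rec c i.+1 j) (axis_rec c i j).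
move: (h 0) (h 1) (h (1 *+ 2)) (tor_dimSE i.+2 (j + 1)) (tor_dimSE i.+1 j).
move: (strand_rec i.+2 (j + 1)) (strand_rec i.+1 (j + 1)).
move: (strand_axis i.+2 (j + 1)) (strand_axis i.+1 (j + 1)).
move: (strand_rec i.+1 j) (strand_axis i.+1 j) (strand_axis i j).
move: (n_succ i.+2 j) (n_succ i.+1 j); lia.
Qed.

(** The same elimination at the first step, where no earlier axis recursion is available and
    [strand_rank_le] supplies an inequality in its place. *)
Lemma tor_dim_alpha j : (tor_dim F 2 (j + 1) <= 2 * tor_dim F 1 j)%N.
Proof.
have h c := axis_rec c 0 j.
move: (h 0) (h 1) (h (1 *+ 2)) (tor_dimSE 1 (j + 1)) (tor_dimSE 0 j).
move: (strand_rec 1 (j + 1)) (strand_rec 0 j).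
move: (strand_axis 1 (j + 1)) (strand_axis 0 (j + 1)) (strand_axis 0 j).
move: (strand_rank_le axis_diff_filtered tor_diffE 0 j) (n_succ 1 j); lia.
Qed.

(* The excess of the sum of the Hilbert functions of the quotients M/(y,z)M,
   M/(x,z)M, M/(x,y)M over three times that of M/(x,y,z)M. *)
Definition axes_excess j : nat :=
  3 * n 0 (j + 1) - (R 0 0 (j + 1) + R 1 0 (j + 1) + R (1 *+ 2) 0 (j + 1))
  - 3 * tor_dim F 0 j.

Lemma tor_dim_gamma j :
  (3 * tor_dim F 0 j + tor_dim F 2 (j + 2) + axes_excess j =
   3 * tor_dim F 1 (j + 1) + axes_excess (j + 1))%N.
Proof.
rewrite /axes_excess (_ : j + 2 = j + 1 + 1); last by rewrite -addrA.
have h c := axis_rec c 0 (j + 1).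
(* These bounds show that the truncated subtractions in [axes_excess] are exact. *)
have l c := axis_rank_res_le axis_diff_filtered tor_diffE c 0 j.
have l' c := axis_rank_res_le axis_diff_filtered tor_diffE c 0 (j + 1).
move: (h 0) (h 1) (h (1 *+ 2)) (l 0) (l 1) (l (1 *+ 2)) (l' 0) (l' 1) (l' (1 *+ 2)).
move: (tor_dimSE 1 (j + 1 + 1)) (tor_dimSE 0 (j + 1)) (tor_dim0E j) (tor_dim0E (j + 1)).
move: (strand_rec 1 (j + 1 + 1)) (strand_axis 1 (j + 1 + 1)).
move: (strand_axis 0 (j + 1 + 1)) (n_succ 1 (j + 1)) (n_succ 0 (j + 1)).
by move: (n_succ 0 j); lia.
Qed.

Lemma axes_excess_low j : (forall s : 'I_(r 0), j < deg s) -> axes_excess j = 0%N.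
Proof.
move=> js; suff : n 0 (j + 1) = 0%N by rewrite /axes_excess; lia.
apply/eqP; rewrite mxrank_eq0; apply/eqP/row_matrixP => s; rewrite row0.
have /sub_deg_lt h : (row s (deg_lt k (@fr_deg _ _ F) 0 (j + 1)) <=
  deg_lt k (@fr_deg _ _ F) 0 (j + 1))%MS by exact: row_sub.
by apply/rowP => t; rewrite h ?mxE //; have := js t; lia.
Qed.

(** After dehomogenization a basis vector is a boundary as soon as some power of X times it is one,
    and the boundaries grow with the degree. *)
Lemma axis_rank_full c j : (forall s : 'I_(r 0), exists2 j' : int, j' <= j &
    ((delta_mx 0 s : 'rV[k]_(r 0)) <= deg_lt k (@fr_deg _ _ F) 1 (j' + 1) *m axis_diff c 0)%MS) ->
  n 0 (j + 1) = R c 0 (j + 1).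
Proof.
move=> h; apply/eqP; rewrite eqn_leq (axis_rank_le axis_diff_filtered) andbT.
apply/mxrankS/(submx_trans (submx1 _))/row_subP => s; rewrite row1.
have [j' j'j] := h s.
move=> /sub_mulmxP[a /sub_deg_lt a0 ->]; apply: submxMr; apply/sub_deg_lt => t jt.
by apply: a0; lia.
Qed.

(* In the descending chain generated by the [X_c ^+ m *: g], where [g] is a
   generator, a relation [X_c ^+ m *: g = b *: X_c ^+ m.+1 *: g] forces, in the
   degree of its left-hand side, [X_c ^+ m *: g = 0]. *)
Lemma finite_length_axis c (s : 'I_(r 0)) : finite_length M ->
  exists j' : int, ((delta_mx 0 s : 'rV[k]_(r 0)) <= deg_lt k (@fr_deg _ _ F) 1 (j' + 1) *m axis_diff c 0)%MS.
Proof.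
move=> [l lP]; pose x := axes_var k c; pose g := fr_gen (f := F) s.
have [m [b mb]] : exists m b, x ^+ m *: g = (b * x ^+ m.+1) *: g.
  apply: Classical_Prop.NNPP => nex.
  suff : (l.+1 <= l)%N by rewrite ltnn.
  apply: (lP _ (fun i y => exists b, y = (b * x ^+ (l.+1 - i)) *: g)) => [i _|i il].
    split=> [|b y z [b1 ->] [b2 ->]]; first by exists 0; rewrite mul0r scale0r.
    by exists (b * b1 + b2); rewrite scalerA mulrDl scalerDl mulrA.
  rewrite (_ : (l.+1 - i = (l.+1 - i.+1).+1)%N); last by lia.
  split=> [y [b ->]|]; first by exists (b * x); rewrite exprS mulrA.
  exists (x ^+ (l.+1 - i.+1) *: g); split; first by exists 1; rewrite mul1r.
  by move=> [b e]; apply: nex; exists (l.+1 - i.+1)%N, b.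
pose u : 'rV[B]_(r 0) := (x ^+ m - b * x ^+ m.+1) *: delta_mx 0 s.
have [w uw] : exists w, u = w *m fr_diff F 0.
  apply/fr_exact0; rewrite (bigD1 s) //= big1 => [|t ts].
    by rewrite !mxE !eqxx mulr1 addr0 scalerBl mb subrr.
  by rewrite !mxE eqxx (negbTE ts) mulr0 scale0r.
(* In this degree the term of [u] divisible by X^(m+1) has no coefficient on the axis, so the strand
   of [u] is the basis vector itself. *)
pose j' := deg s + m%:Z.
exists j'; apply/sub_mulmxP; exists (axis_strand c j' w); first exact: axis_strand_lt.
rewrite -axis_strand_mul -uw; apply/rowP => t; rewrite !mxE eqxx.
have [->|ts] /= := eqVneq t s; last first.
  by rewrite mulr0n mulr0 rmorph0 coef0 if_same.
rewrite mulr1 rmorphB rmorphM !rmorphXn /= axis_var eqxx coefB coefXn coefMXn.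
rewrite ifT; last by rewrite /j'; lia.
by rewrite (_ : `|j' - deg s|%N = m) ?eqxx ?ltnSn ?subr0 // /j'; lia.
Qed.

Lemma axes_excess_high : finite_length M ->
  exists J, forall j, J <= j -> axes_excess j = 0%N.
Proof.
move=> fl.
have /fin_all_exists[f fP] (cs : 'I_3 * 'I_(r 0)) := finite_length_axis cs.1 cs.2 fl.
exists (\sum_cs `|f cs|) => j Jj.
have full c : n 0 (j + 1) = R c 0 (j + 1).
  apply: axis_rank_full => s; exists (f (c, s)); last exact: fP (c, s).
  apply: le_trans Jj; rewrite (bigD1 (c, s)) //=.
  by rewrite (le_trans (ler_norm _)) // lerDl sumr_ge0.
by rewrite /axes_excess -!full; lia.
Qed.

End Betti.

(** * Finite sums over integer windows *)

Lemma int_seq_bound (s : seq int) :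
  exists K : nat, forall j, j \in s -> - K%:Z <= j <= K%:Z.
Proof.
exists (\sum_(j <- s) `|j|)%N => j js.
by have := perm_big _ (perm_to_rem js) (op := addn) (P := xpredT)
  (F := fun j : int => `|j|%N) (x := 0%N); rewrite big_cons /=; lia.
Qed.

Lemma sum_supp_seq (R : nmodType) (X Y : seq int) (f : int -> R) :
  uniq X -> uniq Y -> {subset X <= Y} ->
  (forall j, j \in Y -> j \notin X -> f j = 0) ->
  \sum_(j <- X) f j = \sum_(j <- Y) f j.
Proof.
move=> uX uY XY f0.
rewrite [RHS](bigID (mem X)) /= [X in _ + X]big_seq_cond.
rewrite [X in _ + X]big1 ?addr0 => [|j /andP[]]; last exact: f0.
rewrite -[RHS]big_filter; apply: perm_big; apply: uniq_perm => //.
  exact: filter_uniq.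
by move=> j; rewrite mem_filter /=; case: (boolP (j \in X)) => // /XY ->.
Qed.

Definition int_window (lo : int) (N : nat) : seq int :=
  [seq lo + i%:Z | i <- iota 0 N].

Lemma int_window_uniq lo N : uniq (int_window lo N).
Proof. by rewrite map_inj_uniq ?iota_uniq // => i j /addrI[]. Qed.

Lemma mem_int_window lo N j : (j \in int_window lo N) = (lo <= j < lo + N%:Z).
Proof.
apply/mapP/idP => [[i]|h]; first by rewrite mem_iota => iN ->; lia.
by exists (`|j - lo|)%N; rewrite ?mem_iota; lia.
Qed.

Lemma sum_int_window (R : nmodType) lo N (f : int -> R) :
  \sum_(j <- int_window lo N) f j = \sum_(i < N) f (lo + i%:Z).
Proof. by rewrite big_map -[N in iota 0 N]subn0 -/(index_iota 0 N) big_mkord. Qed.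

Lemma sum_delta_window (R : nzRingType) lo N (V : int -> R) x :
  (forall y, V y != 0 -> lo <= y < lo + N%:Z) ->
  \sum_(i < N) V (lo + i%:Z) * (x == lo + i%:Z)%:R = V x.
Proof.
move=> hV; rewrite -(sum_int_window lo N (fun y => V y * (x == y)%:R)).
have [Vx|/hV] := eqVneq (V x) 0.
  rewrite big1 ?Vx // => y _; case: eqP => [<-|_]; rewrite ?mulr0 //.
  by rewrite Vx mul0r.
rewrite -mem_int_window => xin; rewrite (bigD1_seq x) ?int_window_uniq //=.
rewrite eqxx mulr1 big1 ?addr0 // => y yx.
by rewrite eq_sym (negbTE yx) mulr0.
Qed.

(** * The functionals on tables, and their values on Betti tables *)

Section Functionals.
Implicit Types (v : table) (l j lo : int).

Lemma gammaE v l Y : uniq Y -> {subset gamma_supp v <= Y} ->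
  gamma l v = \sum_(j <- Y | j <= l) gamma_term v j.
Proof.
move=> uY sY; rewrite /gamma -[LHS]big_filter -[RHS]big_filter.
apply: sum_supp_seq; rewrite ?filter_uniq ?fset_uniq // => j.
  by rewrite !mem_filter => /andP[-> /sY].
by rewrite !mem_filter => /andP[-> _] /= /gamma_term_supp.
Qed.

Lemma gamma_inftyE v Y : uniq Y -> {subset gamma_supp v <= Y} ->
  gamma_infty v = \sum_(j <- Y) gamma_term v j.
Proof.
move=> uY sY; apply: sum_supp_seq; rewrite ?fset_uniq // => j _.
exact: gamma_term_supp.
Qed.

Lemma gamma_window v lo N : (forall j, j \in gamma_supp v -> lo <= j) ->
  gamma (lo + N%:Z) v = \sum_(i < N.+1) gamma_term v (lo + i%:Z).
Proof.
move=> lov; rewrite -sum_int_window /gamma -big_filter.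
apply: sum_supp_seq; rewrite ?filter_uniq ?fset_uniq ?int_window_uniq // => j.
  by rewrite mem_filter mem_int_window => /andP[jl /lov ->] /=; lia.
rewrite mem_int_window mem_filter => jw; rewrite (_ : j <= _) //=; last by lia.
exact: gamma_term_supp.
Qed.

Lemma gamma_infty_window v lo N :
  (forall j, j \in gamma_supp v -> lo <= j < lo + N%:Z) ->
  gamma_infty v = \sum_(i < N) gamma_term v (lo + i%:Z).
Proof.
move=> lov; rewrite -sum_int_window; apply: gamma_inftyE.
  exact: int_window_uniq.
by move=> j /lov; rewrite mem_int_window.
Qed.

Lemma table_supp v i j : (i <= 2)%N -> v i j != 0 -> j - i%:Z \in gamma_supp v.
Proof.
move=> i2 nz; have js : j \in finsupp (v i) by rewrite mem_finsupp.
case: i i2 nz js => [|[|[|//]]] _ nz js; rewrite !inE.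
- by rewrite subr0 js.
- by apply/orP; left; apply/orP; right; apply/imfsetP; exists j.
- by apply/orP; right; apply/imfsetP; exists j.
Qed.

Lemma facet_cone_comb v n (c : 'I_n -> rat) (g : 'I_n -> table) :
  (forall s, 0 <= c s) -> (forall s, facet_cone_fl (g s)) ->
  (forall i j, v i j = \sum_(s < n) c s * g s i j) -> facet_cone_fl v.
Proof.
move=> c0 fg vE.
have alphaE l : alpha l v = \sum_s c s * alpha l (g s).
  rewrite /alpha /eps !vE mulr_sumr -sumrB; apply: eq_bigr => s _; ring.
have termE j : gamma_term v j = \sum_s c s * gamma_term (g s) j.
  rewrite /gamma_term /eps !vE !mulr_sumr -sumrB -big_split /=.
  by apply: eq_bigr => s _; ring.
(* The range of summation of [gamma] depends on the table; linearity is checked over one finite set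
   that contains all the supports. *)
pose Y := undup (gamma_supp v ++ flatten [seq (gamma_supp (g s) : seq int) | s <- enum 'I_n]).
have uY : uniq Y by exact: undup_uniq.
have vY : {subset gamma_supp v <= Y}.
  by move=> j jv; rewrite mem_undup mem_cat jv.
have gY s : {subset gamma_supp (g s) <= Y}.
  move=> j jg; rewrite mem_undup mem_cat; apply/orP; right.
  apply/flattenP; exists (gamma_supp (g s) : seq int) => //.
  by apply/mapP; exists s; rewrite ?mem_enum.
split=> [i j|]; first by rewrite /eps vE sumr_ge0 // => s _; rewrite mulr_ge0 //; apply: (fg s).1.
split=> [l|].
  by rewrite alphaE sumr_ge0 // => s _; rewrite mulr_ge0 //; apply: (fg s).2.1.
split=> [l|].
  rewrite (gammaE l uY vY) (eq_bigr _ (fun j _ => termE j)) exchange_big /=.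
  apply: sumr_ge0 => s _; rewrite -mulr_sumr -(gammaE l uY (@gY s)).
  by rewrite mulr_ge0 //; apply: (fg s).2.2.1.
split=> [i j i2|].
  rewrite /eps !vE mulr_sumr -sumrB big1 // => s _.
  by have := (fg s).2.2.2.1 i j i2; rewrite /eps mulrCA -mulrBr => ->; rewrite mulr0.
rewrite (gamma_inftyE uY vY) (eq_bigr _ (fun j _ => termE j)) exchange_big /=.
apply: big1 => s _; rewrite -mulr_sumr -(gamma_inftyE uY (@gY s)).
by rewrite (fg s).2.2.2.2 mulr0.
Qed.

Lemma betti_facet (k : fieldType) (M : gradedModule k) v :
  finite_length M -> is_betti_table M v -> facet_cone_fl v.
Proof.
move=> fl [F vE]; pose E j : rat := (axes_excess F j)%:R.
have termE j : gamma_term v j = E (j + 1) - E j.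
  rewrite /gamma_term /eps !vE /E.
  have /(congr1 (fun n : nat => n%:R : rat)) := tor_dim_gamma F j.
  by rewrite !(natrM, natrD) => h; lra.
have tele lo N : \sum_(i < N) gamma_term v (lo + i%:Z) = E (lo + N%:Z) - E lo.
  elim: N => [|N IH]; first by rewrite big_ord0 addr0 subrr.
  by rewrite big_ord_recr /= IH termE (_ : lo + N.+1%:Z = lo + N%:Z + 1); [ring | lia].
have [K hK] := int_seq_bound (gamma_supp v ++ codom (@fr_deg _ _ F 0)).
have Ksupp j : j \in gamma_supp v -> - K%:Z <= j <= K%:Z.
  by move=> js; apply: hK; rewrite mem_cat js.
have low lo : lo < - K%:Z -> E lo = 0.
  move=> lK; rewrite /E axes_excess_low // => s.
  have : - K%:Z <= fr_deg s <= K%:Z by apply: hK; rewrite mem_cat codom_f orbT.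
  by lia.
split=> [i j|]; first by rewrite /eps vE ler0n.
split=> [l|].
  by rewrite /alpha /eps !vE subr_ge0 -natrM ler_nat tor_dim_alpha.
split=> [l|].
  (* A start below [l], the support and all generator degrees, so that the telescoped sum begins
     with excess 0. *)
  pose lo := - (K + 1 + `|l|)%N%:Z.
  have [N ->] : exists N : nat, l = lo + N%:Z by exists `|l - lo|%N; rewrite /lo; lia.
  rewrite gamma_window => [|j /Ksupp]; last by rewrite /lo; lia.
  by rewrite tele (low lo); [rewrite subr0 ler0n | rewrite /lo; lia].
split=> [[|[|i]] j // _|].
  by rewrite /eps !vE tor_dim_double natrM subrr.
have [J hJ] := axes_excess_high F fl.
(* The window contains the support and ends at or beyond [J], so the excess is 0 at both ends. *)
pose lo := - (K%:Z + 1); pose N := (`|J| + K + K + 2)%N.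
rewrite (@gamma_infty_window v lo N) => [|j /Ksupp]; last by rewrite /lo /N; lia.
rewrite tele (low lo) ?subr0; last by rewrite /lo; lia.
by rewrite /E hJ //; rewrite /lo /N; lia.
Qed.

End Functionals.

(** * A triangular transport problem with two kinds of demand *)

Section Transport.
Variables (N : nat) (a s t : nat -> rat).
Hypotheses (a_ge0 : forall i, 0 <= a i) (s_ge0 : forall i, 0 <= s i).
Hypothesis t_ge0 : forall i, 0 <= t i.
Let A i : rat := \sum_(j < i) a j.
Let D i : rat := \sum_(j < i) (s j + t j).
Hypothesis D_le_A : forall i, D i <= A i.
Hypothesis D_eq_A : D N = A N.

(* The mixed second difference of [min (A i) (D j)] measures the overlap of the
   [i]-th supply interval with the [j]-th demand interval. *)
Let m i j : rat := Num.min (A i.+1) (D j.+1) - Num.min (A i) (D j.+1)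
             - Num.min (A i.+1) (D j) + Num.min (A i) (D j).

Let AS i : A i.+1 = A i + a i. Proof. exact: big_ord_recr. Qed.
Let DS i : D i.+1 = D i + (s i + t i). Proof. exact: big_ord_recr. Qed.

Let m_ge0 i j : 0 <= m i j.
Proof.
rewrite /m AS DS; move: (A i) (D j) (a_ge0 i) (s_ge0 j) (t_ge0 j) => x y ha hs ht.
case: (leP (x + a i) (y + (s j + t j))) => ?; case: (leP x (y + (s j + t j))) => ?;
  case: (leP (x + a i) y) => ?; case: (leP x y) => ?; lra.
Qed.

Let A_mono i j : (i <= j)%N -> A i <= A j.
Proof.
move=> /subnK <-; elim: (j - i)%N => // d IH.
by rewrite addSn AS; have := a_ge0 (d + i); lra.
Qed.

(** From [D j.+1 <= A j.+1 <= A i], all four minima fall on the [D] side and cancel. *)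
Let m_upper i j : (j < i)%N -> m i j = 0.
Proof.
move=> ji; rewrite /m; have h1 := A_mono ji; have h2 := A_mono (leqnSn i).
have h3 := D_le_A j.+1; have h4 := DS j.
have hs := s_ge0 j; have ht := t_ge0 j.
by rewrite !min_r; lra.
Qed.

Let A_ge0 i : 0 <= A i. Proof. exact: sumr_ge0. Qed.
Let A0 : A 0 = 0. Proof. exact: big_ord0. Qed.
Let D0 : D 0 = 0. Proof. exact: big_ord0. Qed.

Let m_row i : (i < N)%N -> \sum_(j < N) m i j = a i.
Proof.
move=> iN; have tele n : \sum_(j < n) m i j =
    Num.min (A i.+1) (D n) - Num.min (A i) (D n)
    - Num.min (A i.+1) (D 0) + Num.min (A i) (D 0).
  elim: n => [|n IH]; first by rewrite big_ord0; ring.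
  by rewrite big_ord_recr /= IH /m; ring.
rewrite tele D_eq_A D0 !(min_r (A_ge0 _)) !min_l ?A_mono //; last exact: ltnW.
by rewrite AS; ring.
Qed.

Let m_col j : (j < N)%N -> \sum_(i < N) m i j = s j + t j.
Proof.
move=> jN; have tele n : \sum_(i < n) m i j =
    Num.min (A n) (D j.+1) - Num.min (A 0) (D j.+1)
    - Num.min (A n) (D j) + Num.min (A 0) (D j).
  elim: n => [|n IH]; first by rewrite big_ord0; ring.
  by rewrite big_ord_recr /= IH /m; ring.
have D_ge0 i : 0 <= D i by apply: sumr_ge0 => l _; rewrite addr_ge0.
have DN i : (i <= N)%N -> D i <= A N by move=> iN; rewrite (le_trans (D_le_A i)) ?A_mono.
rewrite tele A0 !(min_l (D_ge0 _)) !min_r ?DN //; last exact: ltnW.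
by rewrite DS; ring.
Qed.

(** The northwest corner rule: supplies and demands are laid end to end on a line, and the overlap
    of two intervals is what is shipped between them. Each overlap is then shared between [s] and
    [t] in proportion to the demands. *)
Lemma transport : exists ws wt : nat -> nat -> rat,
  [/\ forall i j, 0 <= ws i j /\ 0 <= wt i j,
      forall i j, (j < i)%N -> ws i j = 0 /\ wt i j = 0,
      forall i, (i < N)%N -> \sum_(j < N) (ws i j + wt i j) = a i,
      forall j, (j < N)%N -> \sum_(i < N) ws i j = s j
    & forall j, (j < N)%N -> \sum_(i < N) wt i j = t j].
Proof.
pose w (u : nat -> rat) i j : rat := m i j * (u j / (s j + t j)).
(* At a point without demand the proportion is a division by zero, which is harmless because the
   overlap is zero as well. *)
have m0 i j : (i < N)%N -> (j < N)%N -> s j + t j = 0 -> m i j = 0.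
  move=> iN jN st0; have := m_col jN; rewrite st0 => /psumr_eq0P h.
  by apply: (h _ (Ordinal iN)) => // i' _; exact: m_ge0.
have col (u : nat -> rat) : (forall j, 0 <= u j <= s j + t j) ->
    forall j, (j < N)%N -> \sum_(i < N) w u i j = u j.
  move=> hu j jN; rewrite -mulr_suml m_col // mulrC.
  have [st0|nz] := eqVneq (s j + t j) 0; last by rewrite divfK.
  by rewrite st0 mulr0; have := hu j; rewrite st0 -eq_le => /eqP.
exists (w s), (w t); split.
- by move=> i j; rewrite !mulr_ge0 ?m_ge0 ?invr_ge0 ?addr_ge0.
- by move=> i j ji; rewrite /w m_upper // !mul0r.
- move=> i iN; rewrite -(m_row iN); apply: eq_bigr => j _.
  rewrite /w -mulrDr -mulrDl.
  have [st0|nz] := eqVneq (s j + t j) 0; last by rewrite divff // mulr1.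
  by rewrite m0 // mul0r.
- by apply: col => j; have := s_ge0 j; have := t_ge0 j; lra.
- by apply: col => j; have := s_ge0 j; have := t_ge0 j; lra.
Qed.

End Transport.

(** * Decomposition of a table of the facet cone into pure tables *)

Lemma pure_tableE d i x : pure_table d i x =
  if deg_at d i is Some e then pure_coef d i * (x == e)%:R else 0.
Proof.
rewrite /pure_table; case: (deg_at d i) => [e|]; last by rewrite fsfun0E.
by rewrite fsfunE inE; case: eqP => _; rewrite ?mulr1 ?mulr0.
Qed.

Lemma cone_fin (G : table -> Prop) (v : table) (T : finType) (c : T -> rat)
    (g : T -> table) :
  (forall x, 0 <= c x) -> (forall x, G (g x)) ->
  (forall i j, v i j = \sum_x c x * g x i j) -> cone G v.
Proof.
move=> c0 gG vE; exists #|T|, (c \o enum_val), (g \o enum_val); split=> [x|x|i j] /=.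
- exact: c0.
- exact: gG.
by rewrite vE (big_enum_val (fun x => c x * g x i j)).
Qed.

Lemma facet_pure v : facet_cone_fl v -> pure_cone_fl v.
Proof.
move=> [v0 [al [ga [rec gi]]]].
have [K hK] := int_seq_bound (gamma_supp v).
pose lo := - K%:Z; pose N := (K + K + 1)%N.
have supp i j : (i <= 2)%N -> v i j != 0 -> lo <= j - i%:Z < lo + N%:Z.
  by move=> i2 /(table_supp i2)/hK; rewrite /lo /N; lia.
(* Supply [i] sits at [d_0 = lo + i] and demand [j] at [d_1 = lo + 1 + j], so [d_0 < d_1] means
   [i <= j]. With [s] and [t] the total weights of the [Deg1] and [DegInf] tables at [d_1], row 1
   must be [s + 3 t] and row 2 must be [6 t]. *)
pose a (i : nat) := v 0%N (lo + i%:Z).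
pose s (i : nat) := v 1%N (lo + 1 + i%:Z) - v 2%N (lo + 2 + i%:Z) / 2.
pose t (i : nat) := v 2%N (lo + 2 + i%:Z) / 6.
have termE (i : nat) : gamma_term v (lo + i%:Z) = 3 * (a i - (s i + t i)).
  rewrite /gamma_term /eps /a /s /t.
  rewrite -!addrA ![i%:Z + _]addrC; lra.
have sumE n : \sum_(i < n) gamma_term v (lo + i%:Z) =
    3 * (\sum_(i < n) a i - \sum_(i < n) (s i + t i)).
  by rewrite -sumrB mulr_sumr; apply: eq_bigr => i _; rewrite termE.
have [|||||ws [wt [w_ge0 w_up w_a w_s w_t]]] := @transport N a s t.
- by move=> i; exact: v0.
- move=> i; have := al (lo + 1 + i%:Z); rewrite /alpha /eps /s.
  rewrite (_ : lo + 1 + i%:Z + 1 = lo + 2 + i%:Z); last by lia.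
  by lra.
- by move=> i; rewrite divr_ge0 //; exact: v0.
- case=> [|n]; first by rewrite !big_ord0.
  have := ga (lo + n%:Z); rewrite gamma_window => [|j /hK]; last by rewrite /lo; lia.
  by rewrite sumE; lra.
- have := gi; rewrite (@gamma_infty_window v lo N) => [|j /hK]; last by rewrite /lo /N; lia.
  by rewrite sumE; lra.
have lt01 : (0 : int) < 1 by [].
(* Pairs with [d_1 <= d_0] carry weight zero and receive a dummy degree sequence. *)
pose dseq (C : forall d0 d1 : int, d0 < d1 -> degreeSequence) (i j : nat) :=
  if (lo + i%:Z < lo + 1 + j%:Z) =P true is ReflectT h then C _ _ h else C _ _ lt01.
pose c (x : ('I_N * 'I_N) + ('I_N * 'I_N)) : rat :=
  match x with inl ij => ws ij.1 ij.2 | inr ij => wt ij.1 ij.2 end.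
pose g (x : ('I_N * 'I_N) + ('I_N * 'I_N)) : table :=
  match x with inl ij => pure_table (dseq Deg1 ij.1 ij.2)
             | inr ij => pure_table (dseq DegInf ij.1 ij.2) end.
apply: (@cone_fin _ v _ c g).
- by move=> [] ij /=; case: (w_ge0 ij.1 ij.2).
- move=> [] ij; eexists; try reflexivity; rewrite /dseq.
    by case: eqP.
  by case: eqP.
have v_rec (n : nat) x : v n.+2 x = 2 ^+ n * v 2%N (x - n%:Z).
  elim: n x => [|n IH] x; first by rewrite mul1r subr0.
  have := rec n.+2 (x - 1) isT; rewrite /eps IH subrK => /eqP.
  rewrite subr_eq0 => /eqP <-; rewrite exprS mulrA; congr (_ * v 2%N _); lia.
move=> n x; rewrite big_sumType /=.
(* The entries of the two kinds of pure tables, written without the condition [d_0 < d_1]; where it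
   fails the weight vanishes. *)
pose P0 (n i j : nat) : rat := if n is 0 then (x == lo + i%:Z)%:R
  else if n is 1 then (x == lo + 1 + j%:Z)%:R else 0.
pose P1 (n i j : nat) : rat := if n is m.+1 then 3 * 2 ^+ m * (x == lo + 1 + m%:Z + j%:Z)%:R
  else (x == lo + i%:Z)%:R.
rewrite [X in X + _](eq_bigr (fun ij : 'I_N * 'I_N => ws ij.1 ij.2 * P0 n ij.1 ij.2)); last first.
  move=> [i j] _ /=; rewrite pure_tableE /dseq; case: eqP => [h|h].
    by case: n => [|[|n]] //=; rewrite /P0 mul1r.
  by have [|-> _] := w_up i j; rewrite ?mul0r //; move: h => /negP; lia.
rewrite [X in _ + X](eq_bigr (fun ij : 'I_N * 'I_N => wt ij.1 ij.2 * P1 n ij.1 ij.2)); last first.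
  move=> [i j] _ /=; rewrite pure_tableE /dseq; case: eqP => [h|h].
    by case: n => [|n] //=; rewrite /P1 ?mul1r // [_ + j%:Z + _]addrAC.
  by have [|_ ->] := w_up i j; rewrite ?mul0r //; move: h => /negP; lia.
rewrite -(pair_bigA _ (fun i j : 'I_N => ws i j * P0 n i j)).
rewrite -(pair_bigA _ (fun i j : 'I_N => wt i j * P1 n i j)) /=.
case: n => [|n]; rewrite /P0 /P1 /=.
  rewrite -big_split /= -[LHS](@sum_delta_window _ lo N); last first.
    by move=> y /supp; rewrite subr0; apply.
  by apply: eq_bigr => i _; rewrite -!mulr_suml -mulrDl -big_split /= w_a.
rewrite [X in _ + X]exchange_big [X in X + _]exchange_big -big_split /=.
case: n => [|n] /=.
  rewrite -[LHS](@sum_delta_window _ (lo + 1) N); last first.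
    by move=> y /supp => /(_ isT); lia.
  apply: eq_bigr => j _; rewrite -!mulr_suml w_s // w_t // !addr0 /s /t; lra.
rewrite -[LHS](@sum_delta_window _ (lo + 2 + n%:Z) N (fun y => v n.+2 y)); last first.
  by move=> y; rewrite v_rec mulf_eq0 negb_or => /andP[_ /supp] => /(_ isT); lia.
apply: eq_bigr => j _; rewrite -!mulr_suml w_t // mulr0 add0r /t v_rec.
rewrite (_ : lo + 2 + n%:Z + j%:Z - n%:Z = lo + 2 + j%:Z); last by lia.
rewrite (_ : lo + 1 + n.+1%:Z + j%:Z = lo + 2 + n%:Z + j%:Z); last by lia.
by rewrite exprS; field.
Qed.

(** * Homogeneous components in B *)

Section Homogeneous.
Variable k : fieldType.
Local Notation B := (axesRing k).
Implicit Types (n m : int) (b : B).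

Lemma axes_homog0 n : axes_homog n (0 : B).
Proof. by case: n => // n; exists 0; rewrite ?rpred0 ?raddf0. Qed.

Lemma axes_homogB n b b' :
  axes_homog n b -> axes_homog n b' -> axes_homog n (b - b').
Proof.
case: n => [n [p hp ->] [q hq ->]|n /= -> ->]; last by rewrite subr0.
by exists (p - q); rewrite ?rpredB ?raddfB.
Qed.

Lemma axes_homogD n b b' :
  axes_homog n b -> axes_homog n b' -> axes_homog n (b + b').
Proof.
move=> hb hb'; rewrite -[b']opprK -[- b']sub0r.
by apply: axes_homogB => //; apply: axes_homogB => //; apply: axes_homog0.
Qed.

Lemma axes_homogM n m b b' :
  axes_homog n b -> axes_homog m b' -> axes_homog (n + m) (b * b').
Proof.
case: n => [n|n ->]; last by rewrite mul0r => _; apply: axes_homog0.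
case: m => [m|m hb ->]; last by rewrite mulr0; apply: axes_homog0.
move=> [p hp ->] [q hq ->]; exists (p * q); last by rewrite rmorphM.
exact: dhomogM.
Qed.

Lemma axes_homog_const a : axes_homog 0 (axes_const a : B).
Proof. by exists a%:MP => //; rewrite -alg_mpolyC rpredZ ?dhomog1. Qed.

Lemma axes_homog_var c : axes_homog 1 (axes_var k c).
Proof. by exists 'X_c => //; rewrite dhomogX /= mdeg1. Qed.

Lemma axes_homog_varX c (n : nat) : axes_homog n (axes_var k c ^+ n).
Proof.
elim: n => [|n IH]; first by rewrite expr0 -(rmorph1 (@axes_const k)); apply: axes_homog_const.
by rewrite exprS (_ : n.+1%:Z = 1 + n%:Z) //; apply: axes_homogM IH; apply: axes_homog_var.
Qed.

Lemma axes_homog_sum n (I : Type) (r : seq I) (P : pred I) (f : I -> B) :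
  (forall i, P i -> axes_homog n (f i)) -> axes_homog n (\sum_(i <- r | P i) f i).
Proof.
by move=> hf; elim/big_ind: _ => //; [apply: axes_homog0 | move=> *; apply: axes_homogD].
Qed.

(** Degree 0 is separate because the axes share a single constant term. *)
Definition axes_comp (n : nat) b : B :=
  if n is 0 then axes_const (axes_res b)
  else \sum_c axes_const (axis c b)`_n * axes_var k c ^+ n.

Lemma axis_comp c (n : nat) b : axis c (axes_comp n b) = (axis c b)`_n *: 'X^n.
Proof.
case: n => [|n] /=; first by rewrite axis_const (axes_res_axis c) expr0 alg_polyC.
rewrite rmorph_sum /= (bigD1 c) //= big1 ?addr0 => [|c' nc].
  by rewrite rmorphM rmorphXn /= axis_const axis_var eqxx mul_polyC.
by rewrite rmorphM rmorphXn /= axis_var (negbTE nc) expr0n mulr0.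
Qed.

Lemma axes_comp_homog (n : nat) b : axes_homog n (axes_comp n b).
Proof.
case: n => [|n]; first exact: axes_homog_const.
apply: axes_homog_sum => c _; rewrite -[X in axes_homog X _]add0r.
by apply: axes_homogM; [apply: axes_homog_const | apply: axes_homog_varX].
Qed.

Lemma axes_comp_sum (n : nat) (I : Type) (r : seq I) (P : pred I) (f : I -> B) :
  axes_comp n (\sum_(i <- r | P i) f i) = \sum_(i <- r | P i) axes_comp n (f i).
Proof.
apply: axis_inj => c; rewrite axis_comp !rmorph_sum /= coef_sum scaler_suml.
by apply: eq_bigr => i _; rewrite axis_comp.
Qed.

Lemma axes_comp_mul (n m : nat) b h : axes_homog m h ->
  axes_comp n (b * h) = if (m <= n)%N then axes_comp (n - m) b * h else 0.
Proof.
move=> hh; apply: axis_inj => c; rewrite axis_comp rmorphM /=.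
rewrite (axes_homog_axis c hh) -scalerAr coefZ coefMXn.
case: leqP => mn; last by rewrite mulr0 scale0r rmorph0.
rewrite rmorphM /= axis_comp [in RHS](axes_homog_axis c hh).
by rewrite -scalerAr -scalerAl -exprD subnK // scalerA.
Qed.

Lemma axes_comp_id (n m : nat) b :
  axes_homog m b -> axes_comp n b = if n == m then b else 0.
Proof.
move=> hb; apply: axis_inj => c; rewrite axis_comp (axes_homog_axis c hb).
rewrite coefZ coefXn; case: eqP => [->|_]; first by rewrite mulr1 -axes_homog_axis.
by rewrite mulr0 scale0r rmorph0.
Qed.

Lemma axes_comp_decomp b : exists N : nat, b = \sum_(n < N) axes_comp n b.
Proof.
exists (\max_c size (axis c b))%N; apply: axis_inj => c; rewrite rmorph_sum /=.
rewrite (eq_bigr _ (fun (i : 'I__) _ => axis_comp c i b)).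
have := leq_bigmax (F := fun c => size (axis c b)) c.
move: (\max_c _) => N le; apply/polyP => i; rewrite coef_sumMXn.
have [iN|Ni] := ltnP i N; last by rewrite big1 ?nth_default ?(leq_trans le) // => -[j jN] /= /eqP ji; lia.
rewrite (bigD1 (Ordinal iN)) //= big1 ?addr0 // => j /andP[/eqP ji].
by case/eqP; apply: val_inj.
Qed.

End Homogeneous.

(** * Finite length from a finite spanning family over the field *)

Section FiniteLength.
Variables (k : fieldType) (M : lmodType (axesRing k)).

Lemma submodule_sum (N : M -> Prop) n (b : 'I_n -> axesRing k) (x : 'I_n -> M) :
  submodule N -> (forall i, b i != 0 -> N (x i)) -> N (\sum_i b i *: x i).
Proof.
move=> [N0 NZ] hx; elim/big_ind: _ => //.
  by move=> y z Ny Nz; rewrite -[y]scale1r; apply: NZ.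
move=> i _; have [->|/hx Nx] := eqVneq (b i) 0; first by rewrite scale0r.
by rewrite -[_ *: _]addr0; apply: NZ.
Qed.

(** Choosing one new element at each step of a strict chain gives vectors with linearly independent
    coordinate rows, so the chain is no longer than the spanning family. *)
Lemma finite_length_span (T : finType) (g : T -> M) :
  (forall x, exists a : T -> k, x = \sum_t axes_const (a t) *: g t) ->
  finite_length M.
Proof.
move=> gen; exists #|T| => l N subN strN.
have mono i j : (i <= j <= l)%N -> forall x, N i x -> N j x.
  move=> /andP[/subnK <-]; elim: (j - i)%N => // d IH dl x Nx.
  by apply: (strN _ _).1; [rewrite -addSn | apply: IH Nx; lia].
have /fin_all_exists[y yP] (i : 'I_l) := (strN i (ltn_ord i)).2.
have /fin_all_exists[a aP] (i : 'I_l) := gen (y i).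
pose V : 'M[k]_(l, #|T|) := \matrix_(i, t) a i (enum_val t).
suff /eqP <- : row_free V by exact: rank_leq_col.
apply: inj_row_free => u uV; apply/eqP; apply: contraT => /rV0Pn[i1 ui1].
(* The last element with a nonzero coefficient is a combination of earlier ones, hence lies in
   [N i0], against its choice. *)
have [i0 ui0 max0] := @arg_maxnP _ i1 (fun i => u 0 i != 0) (fun i => val i) ui1.
case: (yP i0) => _; case.
have rel : \sum_i axes_const (u 0 i) *: y i = 0.
  rewrite (eq_bigr (fun i => \sum_t axes_const (u 0 i * a i t) *: g t)).
    rewrite exchange_big big1 //= => t _; rewrite -scaler_suml -rmorph_sum.
    have /rowP/(_ (enum_rank t)) := uV; rewrite !mxE.
    under eq_bigr do rewrite mxE enum_rankK.
    by move=> ->; rewrite rmorph0 scale0r.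
  move=> i _; rewrite {1}(aP i) scaler_sumr; apply: eq_bigr => t _.
  by rewrite scalerA -rmorphM.
have -> : y i0 = \sum_i axes_const (if i == i0 then 0 else - (u 0 i0)^-1 * u 0 i) *: y i.
  have -> : y i0 = axes_const ((u 0 i0)^-1) *: (axes_const (u 0 i0) *: y i0).
    by rewrite scalerA -rmorphM mulVf // rmorph1 scale1r.
  move: rel; rewrite (bigD1 i0) //= => /eqP; rewrite addr_eq0 => /eqP ->.
  rewrite [RHS](bigD1 i0) //= eqxx rmorph0 scale0r add0r -sumrN scaler_sumr.
  apply: eq_bigr => i /negbTE ->.
  by rewrite -scaleNr scalerA -rmorphN -rmorphM mulrN mulNr.
apply: submodule_sum; first by apply: subN; apply: ltnW.
move=> i; case: (eqVneq i i0) => [_|ne]; first by rewrite rmorph0 eqxx.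
have [->|ui] := eqVneq (u 0 i) 0; first by rewrite mulr0 rmorph0 eqxx.
move=> _; apply: (mono i.+1); last exact: (yP i).1.
by rewrite (ltnW (ltn_ord i0)) andbT ltn_neqAle ne; apply: max0.
Qed.

End FiniteLength.

(** * Graded cyclic modules, quotients of B by forms of one degree *)

Section CyclicModule.
Variables (k : fieldType) (q : nat) (f : 'I_q -> axesRing k) (e : nat).
Hypothesis f_homog : forall s, axes_homog e (f s).
Local Notation B := (axesRing k).
Implicit Types b : B.

Definition gen_ideal b : bool :=
  if ClassicalEpsilon.excluded_middle_informative
    (exists w : 'rV[B]_q, b = \sum_s w 0 s * f s) then true else false.

Lemma gen_idealP b :
  reflect (exists w : 'rV[B]_q, b = \sum_s w 0 s * f s) (gen_ideal b).
Proof.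
rewrite /gen_ideal.
by case: ClassicalEpsilon.excluded_middle_informative => h; constructor.
Qed.

Lemma gen_ideal_zmod : zmod_closed gen_ideal.
Proof.
split=> [|b b' /gen_idealP[w ->] /gen_idealP[w' ->]]; apply/gen_idealP.
  by exists 0; rewrite big1 // => s _; rewrite mxE mul0r.
exists (w - w'); rewrite -sumrB; apply: eq_bigr => s _.
by rewrite !mxE mulrBl.
Qed.

HB.instance Definition _ := GRing.isZmodClosed.Build B gen_ideal gen_ideal_zmod.

Lemma gen_idealM b b' : b' \in gen_ideal -> b * b' \in gen_ideal.
Proof.
move=> /gen_idealP[w ->]; apply/gen_idealP; exists (b *: w).
by rewrite mulr_sumr; apply: eq_bigr => s _; rewrite mxE mulrA.
Qed.

(** The quotient is taken as an additive group and given its scaling afterwards; a ring quotient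
    would require the ideal to be proper. *)
Definition gen_zmod : zmodClosed B := GRing.ZmodClosed.clone B gen_ideal _.

Definition cyclic_module := Quotient.quot gen_zmod.
HB.instance Definition _ := GRing.Zmodule.on cyclic_module.

Definition cyclic_proj b : cyclic_module := \pi_(Quotient.quot gen_zmod) b.

Lemma cyclic_proj_is_additive : zmod_morphism cyclic_proj.
Proof. by move=> b b'; rewrite /cyclic_proj raddfB. Qed.
HB.instance Definition _ :=
  GRing.isZmodMorphism.Build B cyclic_module cyclic_proj cyclic_proj_is_additive.

Lemma cyclic_proj_eq b b' : cyclic_proj b = cyclic_proj b' <-> b - b' \in gen_ideal.
Proof. by rewrite (Quotient.idealrBE gen_zmod); split=> [h|/eqP]; first apply/eqP. Qed.

Lemma cyclic_proj_eq0 b : cyclic_proj b = 0 <-> b \in gen_ideal.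
Proof. by rewrite -(raddf0 cyclic_proj) cyclic_proj_eq subr0. Qed.

Lemma cyclic_projP (x : cyclic_module) : exists b, x = cyclic_proj b.
Proof. by exists (repr x); rewrite /cyclic_proj reprK. Qed.

Definition cyclic_scale b (x : cyclic_module) : cyclic_module :=
  cyclic_proj (b * repr x).

Lemma cyclic_scaleE b b' : cyclic_scale b (cyclic_proj b') = cyclic_proj (b * b').
Proof.
apply/cyclic_proj_eq; rewrite -mulrBr; apply: gen_idealM.
by apply/cyclic_proj_eq; rewrite {1}/cyclic_proj reprK.
Qed.

Lemma cyclic_scaleA a b x : cyclic_scale a (cyclic_scale b x) = cyclic_scale (a * b) x.
Proof. by have [y ->] := cyclic_projP x; rewrite !cyclic_scaleE mulrA. Qed.

Lemma cyclic_scale1 : left_id 1 cyclic_scale.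
Proof. by move=> x; have [y ->] := cyclic_projP x; rewrite cyclic_scaleE mul1r. Qed.

Lemma cyclic_scaleDr : right_distributive cyclic_scale +%R.
Proof.
move=> b x y; have [x' ->] := cyclic_projP x; have [y' ->] := cyclic_projP y.
by rewrite -raddfD !cyclic_scaleE mulrDr raddfD.
Qed.

Lemma cyclic_scaleDl x : {morph cyclic_scale^~ x : a b / a + b}.
Proof.
move=> a b; have [x' ->] := cyclic_projP x.
by rewrite !cyclic_scaleE mulrDl raddfD.
Qed.

HB.instance Definition _ := GRing.Zmodule_isLmodule.Build B cyclic_module
  cyclic_scaleA cyclic_scale1 cyclic_scaleDr cyclic_scaleDl.

Lemma cyclic_projM b b' : b *: cyclic_proj b' = cyclic_proj (b * b').
Proof. exact: cyclic_scaleE. Qed.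

(** All generators have degree [e], so a component of a combination is the combination of the
    components of degree [n - e] of its coefficients. *)
Lemma gen_ideal_comp n b : b \in gen_ideal -> axes_comp n b \in gen_ideal.
Proof.
move=> /gen_idealP[w ->]; rewrite axes_comp_sum.
rewrite (eq_bigr _ (fun s _ => axes_comp_mul n (w 0 s) (f_homog s))).
case: leqP => _; last by rewrite big1 ?rpred0.
apply/gen_idealP; exists (\row_s axes_comp (n - e) (w 0 s)).
by apply: eq_bigr => s _; rewrite mxE.
Qed.

Variable d0 : int.

Definition cyclic_piece (j : int) (x : cyclic_module) : Prop :=
  exists2 b, axes_homog (j - d0) b & x = cyclic_proj b.

Lemma cyclic_piece0 j : cyclic_piece j 0.
Proof. by exists 0; rewrite ?raddf0 //; apply: axes_homog0. Qed.

Lemma cyclic_pieceB j x y :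
  cyclic_piece j x -> cyclic_piece j y -> cyclic_piece j (x - y).
Proof.
move=> [a ha ->] [b hb ->]; exists (a - b); rewrite ?raddfB //.
exact: axes_homogB.
Qed.

Lemma cyclic_pieceM n j b x :
  axes_homog n b -> cyclic_piece j x -> cyclic_piece (n + j) (b *: x).
Proof.
move=> hb [a ha ->]; exists (b * a); rewrite ?cyclic_projM // -addrA.
exact: axes_homogM.
Qed.

Lemma cyclic_span (x : cyclic_module) :
  exists (s : seq int) (g : int -> cyclic_module),
    (forall j, cyclic_piece j (g j)) /\ x = \sum_(j <- s) g j.
Proof.
have [b ->] := cyclic_projP x; have [N bE] := axes_comp_decomp b.
exists (int_window d0 N), (fun j : int => if d0 <= j then
  cyclic_proj (axes_comp `|j - d0|%N b) else 0); split=> [j|].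
  case: leP => dj; last exact: cyclic_piece0.
  exists (axes_comp `|j - d0|%N b) => //.
  have {1}-> : j - d0 = `|j - d0|%N by lia.
  exact: axes_comp_homog.
rewrite sum_int_window {1}bE raddf_sum; apply: eq_bigr => i _ /=.
by rewrite lerDl le0z_nat addrAC subrr add0r.
Qed.

Lemma cyclic_direct (s : seq int) (g : int -> cyclic_module) :
  uniq s -> (forall j, cyclic_piece j (g j)) -> \sum_(j <- s) g j = 0 ->
  forall j, j \in s -> g j = 0.
Proof.
move=> us gP sum0 j js.
have ex i : exists b, axes_homog (i - d0) b /\ g i = cyclic_proj b.
  by have [b ? ?] := gP i; exists b.
pose b i := sval (ClassicalEpsilon.constructive_indefinite_description _ (ex i)).
have bP i : axes_homog (i - d0) (b i) /\ g i = cyclic_proj (b i).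
  exact: (svalP (ClassicalEpsilon.constructive_indefinite_description _ (ex i))).
move: sum0; rewrite (eq_bigr _ (fun i _ => (bP i).2)) -raddf_sum.
(* The relation, lifted to homogeneous representatives, lies in the homogeneous ideal; its component
   of degree [j - d0] is the representative of [g j]. *)
move=> /cyclic_proj_eq0/(gen_ideal_comp `|j - d0|%N); rewrite axes_comp_sum.
rewrite (bP j).2; case: (ltP j d0) => [dj _|dj].
  have := (bP j).1; rewrite (_ : j - d0 = Negz `|d0 - j|.-1%N); last by lia.
  by move=> ->; rewrite raddf0.
suff -> : \sum_(i <- s) axes_comp `|j - d0|%N (b i) = b j by move/cyclic_proj_eq0.
rewrite (bigD1_seq j) //= big1 ?addr0 => [|i ij]; last first.
  have := (bP i).1; case: (ltP i d0) => di.
    rewrite (_ : i - d0 = Negz `|d0 - i|.-1%N); last by lia.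
    move=> ->; have h0 : axes_homog 0%N (0 : B) by exact: axes_homog0.
    by rewrite (axes_comp_id _ h0) if_same.
  rewrite (_ : i - d0 = `|i - d0|%N); last by lia.
  by move/(axes_comp_id `|j - d0|%N) ->; rewrite ifF //; apply/eqP; lia.
have := (bP j).1; rewrite {1}(_ : j - d0 = `|j - d0|%N); last by lia.
by move/(axes_comp_id `|j - d0|%N) ->; rewrite eqxx.
Qed.

Definition cyclic_graded : gradedModule k := GradedModule
  cyclic_piece0 cyclic_pieceB cyclic_pieceM cyclic_span cyclic_direct.

(** Powers of the variables span B over the field, and those of exponent above [K] die in the
    quotient. *)
Lemma cyclic_finite_length (K : nat) :
  (forall c, axes_var k c ^+ K \in gen_ideal) -> finite_length cyclic_graded.
Proof.
move=> hK.
pose g (t : 'I_3 * 'I_K.+1) : cyclic_module := cyclic_proj (axes_var k t.1 ^+ t.2).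
apply: (@finite_length_span _ _ _ g) => x.
pose S (x : cyclic_module) := exists a, x = \sum_t axes_const (a t) *: g t.
have S0 : S 0.
  by exists (fun=> 0); rewrite big1 // => t _; rewrite rmorph0 scale0r.
have SD y z : S y -> S z -> S (y + z).
  move=> [a ->] [a' ->]; exists (fun t => a t + a' t); rewrite -big_split.
  by apply: eq_bigr => t _; rewrite rmorphD scalerDl.
have Sg a t : S (axes_const a *: g t).
  exists (fun t' => if t' == t then a else 0); rewrite (bigD1 t) //= eqxx.
  by rewrite big1 ?addr0 // => t' /negbTE ->; rewrite rmorph0 scale0r.
have [b ->] := cyclic_projP x; rewrite -/(S _) (axes_decomp b) raddfB raddf_sum.
apply: (SD _ _).
  apply: (big_ind S S0 SD) => c _ /=; rewrite /axis_lift horner_coef raddf_sum.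
  apply: (big_ind S S0 SD) => i _ /=; rewrite coef_map /= -cyclic_projM.
  have [iK|Ki] := leqP i K; first exact: (Sg _ (c, Ordinal (iK : (i < K.+1)%N))).
  rewrite -(subnK (ltnW Ki)) exprD -cyclic_projM.
  by move/cyclic_proj_eq0: (hK c) => ->; rewrite !scaler0.
have -> : - cyclic_proj (axes_const (axes_res b) *+ 2) =
    axes_const (- (axes_res b *+ 2)) *: g (0, 0).
  by rewrite cyclic_projM expr0 mulr1 rmorphN rmorphMn raddfN.
exact: Sg.
Qed.

End CyclicModule.

(** * Resolutions of cyclic modules that are linear after the first step *)

Section CyclicResolution.
Variables (k : fieldType) (rk : nat -> nat) (f : 'I_(rk 0) -> axesRing k) (e : nat).
Hypothesis f_homog : forall s, axes_homog e (f s).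
Local Notation B := (axesRing k).
Variables (d0 : int) (df : forall i, 'M[B]_(rk i.+1, rk i)).
Hypothesis df_homog : forall i s t, axes_homog 1 (df i s t).
Hypothesis df_exact0 : forall u : 'rV[B]_(rk 0),
  \sum_s u 0 s * f s = 0 <-> exists w, u = w *m df 0.
Hypothesis df_exact : forall i (u : 'rV[B]_(rk i.+1)),
  u *m df i = 0 <-> exists w, u = w *m df i.+1.

Local Notation M := (cyclic_graded f_homog d0).

Definition cyc_rank i : nat := if i is i'.+1 then rk i' else 1%N.
Definition cyc_deg i : int := if i is i'.+1 then d0 + e%:Z + i'%:Z else d0.

Definition cyc_diff i : 'M[B]_(cyc_rank i.+1, cyc_rank i) :=
  match i with 0 => \col_s f s | i'.+1 => df i' end.

Definition cyc_gen (s : 'I_(cyc_rank 0)) : M := cyclic_proj f 1.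

Lemma cyc_diff_homog i s t : axes_homog (cyc_deg i.+1 - cyc_deg i) (cyc_diff i s t).
Proof.
case: i s t => [|i] s t /=; first by rewrite mxE (_ : _ - _ = e%:Z) //; lia.
by rewrite (_ : _ - _ = 1) //; lia.
Qed.

Lemma cyc_gen_homog s : gm_piece (cyc_deg 0) (cyc_gen s).
Proof.
exists 1 => //=; rewrite subrr -(rmorph1 (@axes_const k)); exact: axes_homog_const.
Qed.

Lemma cyc_genE (u : 'rV[B]_(cyc_rank 0)) :
  \sum_s u 0 s *: cyc_gen s = cyclic_proj f (u 0 0) :> M.
Proof. by rewrite big_ord1 cyclic_projM mulr1. Qed.

Lemma cyc_gen_surj (x : M) : exists u : 'rV[B]_(cyc_rank 0),
  x = \sum_s u 0 s *: cyc_gen s.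
Proof.
have [b ->] := cyclic_projP x; exists (\row_s b).
by rewrite cyc_genE mxE.
Qed.

Lemma cyc_exact0 (u : 'rV[B]_(cyc_rank 0)) :
  \sum_s u 0 s *: cyc_gen s = 0 :> M <-> exists w, u = w *m cyc_diff 0.
Proof.
rewrite cyc_genE cyclic_proj_eq0; split=> [/gen_idealP[w uw]|[w ->]].
  exists w; apply/rowP => t; rewrite (ord1 t) uw mxE.
  by apply: eq_bigr => s _; rewrite mxE.
apply/gen_idealP; exists w; rewrite mxE.
by apply: eq_bigr => s _; rewrite mxE.
Qed.

Lemma cyc_exact i (u : 'rV[B]_(cyc_rank i.+1)) :
  u *m cyc_diff i = 0 <-> exists w, u = w *m cyc_diff i.+1.
Proof.
case: i u => [|i] u /=; last exact: df_exact.
rewrite -df_exact0; split=> [/rowP/(_ 0)|h].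
  by rewrite !mxE => h; rewrite -[RHS]h; apply: eq_bigr => s _; rewrite mxE.
apply/rowP => t; rewrite !mxE -[RHS]h.
by apply: eq_bigr => s _; rewrite mxE.
Qed.

Definition cyclic_resolution : freeResolution M :=
  @FreeResolution k M cyc_rank (fun i _ => cyc_deg i) cyc_diff cyc_gen
    cyc_diff_homog cyc_gen_homog cyc_gen_surj cyc_exact0 cyc_exact.

Hypothesis e_gt0 : (0 < e)%N.

(** The resolution is minimal: each term is generated in one degree, and these degrees strictly
    increase. *)
Lemma cyclic_tor_diff i : tor_diff cyclic_resolution i = 0.
Proof.
apply/matrixP => s t; rewrite (tor_diffE 0) [RHS]mxE ifF //=.
by apply/eqP; case: i s t => [|i] s t /=; lia.
Qed.

Lemma cyclic_tor_dim i j :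
  tor_dim cyclic_resolution i j = if j == cyc_deg i then cyc_rank i else 0%N.
Proof.
have -> : tor_dim cyclic_resolution i j = \rank (tor_term cyclic_resolution i j).
  rewrite /tor_dim /tor_boundaries cyclic_tor_diff mulmx0 mxrank0 subn0.
  case: i => [|i] //=; rewrite cyclic_tor_diff.
  by have := mxrank_mul_ker (tor_term cyclic_resolution i.+1 j)
    (0 : 'M_(_, cyc_rank i)); rewrite mulmx0 mxrank0.
have -> : tor_term cyclic_resolution i j = (j == cyc_deg i)%:R%:M.
  by apply/matrixP => s t; rewrite !mxE eq_sym.
by case: eqP => _; rewrite ?mxrank1 // raddf0 mxrank0.
Qed.

End CyclicResolution.

(** * Modules of finite length whose Betti tables are the pure tables *)

Section PureModules.
Variable k : fieldType.
Local Notation B := (axesRing k).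
Implicit Types (c : 'I_3) (b : B).

Lemma polyMX_eq0 (p : {poly k}) n : (p * 'X^n = 0) <-> p = 0.
Proof.
split=> [/eqP|->]; last by rewrite mul0r.
by rewrite mulf_eq0 expf_eq0 polyX_eq0 andbF orbF => /eqP.
Qed.

Section Deg1.
Variables (d0 d1 : int) (lt_d : d0 < d1).
Let e := `|d1 - d0|%N.

Let rk i : nat := if i is 0 then 1%N else 0%N.
Let f (s : 'I_(rk 0)) : B := \sum_c axes_var k c ^+ e.
Let df i : 'M[B]_(rk i.+1, rk i) := 0.

Let e_gt0 : (0 < e)%N. Proof. by rewrite /e; lia. Qed.

Let axis_f c s : axis c (f s) = 'X^e.
Proof.
rewrite rmorph_sum /= (bigD1 c) //= big1 ?addr0 => [|c' nc].
  by rewrite rmorphXn /= axis_var eqxx.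
by rewrite rmorphXn /= axis_var (negbTE nc) expr0n (gtn_eqF e_gt0).
Qed.

Let f_homog s : axes_homog e (f s).
Proof. by apply: axes_homog_sum => c _; apply: axes_homog_varX. Qed.

Let df_homog i s t : axes_homog 1 (df i s t).
Proof. by rewrite mxE; apply: axes_homog0. Qed.

Let df_exact0 (u : 'rV[B]_(rk 0)) :
  \sum_s u 0 s * f s = 0 <-> exists w, u = w *m df 0.
Proof.
split=> [|[w ->]]; last by rewrite big1 // => s _; rewrite mulmx0 mxE mul0r.
rewrite big_ord1 => u0; exists 0; rewrite mul0mx; apply/rowP => s.
rewrite (ord1 s) mxE; apply: axis_inj => c; rewrite rmorph0.
by have := congr1 (axis c) u0; rewrite rmorph0 rmorphM /= axis_f => /polyMX_eq0.
Qed.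

Let df_exact i (u : 'rV[B]_(rk i.+1)) :
  u *m df i = 0 <-> exists w, u = w *m df i.+1.
Proof.
by split=> _; [exists 0; apply/rowP; case | rewrite mulmx0].
Qed.

(** The sum of the [e]-th powers restricts to X^e on every axis, so it is a nonzerodivisor and the
    resolution stops after one step. *)
Lemma deg1_betti : exists2 M : gradedModule k,
  finite_length M & is_betti_table M (pure_table (Deg1 lt_d)).
Proof.
exists (cyclic_graded f_homog d0).
  (* Multiplying the generator by [x_c] leaves only the power [e + 1] of [x_c]. *)
  apply: (@cyclic_finite_length _ _ _ _ _ _ e.+1) => c; apply/gen_idealP.
  exists (\row_s axes_var k c); rewrite big_ord1 mxE; apply: axis_inj => c'.
  rewrite rmorphXn rmorphM /= axis_f axis_var exprS.
  by case: eqP => _; rewrite ?mul0r.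
exists (cyclic_resolution f_homog d0 df_homog df_exact0 df_exact) => i j.
rewrite cyclic_tor_dim // pure_tableE; case: i => [|[|i]] /=.
- by rewrite mul1r; case: eqP.
- rewrite addr0 (_ : d0 + e%:Z = d1) ?mul1r; last by rewrite /e; lia.
  by case: eqP.
- by rewrite if_same.
Qed.

End Deg1.

Section DegInf.
Variables (d0 d1 : int) (lt_d : d0 < d1).
Let e := `|d1 - d0|%N.

Let e_gt0 : (0 < e)%N. Proof. by rewrite /e; lia. Qed.

(** The generators are three powers, one on each axis. A basis vector with image on one axis is
    annihilated by the two other variables, which gives two basis vectors in the next term: three
    binary trees. *)
Fixpoint tree_rank i : nat := if i is i'.+1 then tree_rank i' + tree_rank i' else 3.

(* The axis supporting the image of a basis vector, which is therefore
   annihilated by the other two variables. *)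
Fixpoint tree_axis i : 'I_(tree_rank i) -> 'I_3 :=
  match i with
  | 0 => fun s => s
  | i'.+1 => fun s => match split s with
                     | inl t => tree_axis t + 1
                     | inr t => tree_axis t + 1 *+ 2
                     end
  end.

Definition tree_diff i : 'M[B]_(tree_rank i.+1, tree_rank i) :=
  col_mx (diag_mx (\row_t axes_var k (tree_axis t + 1)))
         (diag_mx (\row_t axes_var k (tree_axis t + 1 *+ 2))).

(** The common description of kernel and image: each coordinate lies in the annihilator attached to
    its basis vector. Exactness follows by comparing both with it. *)
Definition tree_ann i (u : 'rV[B]_(tree_rank i)) : Prop :=
  forall s, axis (tree_axis s) (u 0 s) = 0.

Lemma tree_rankE i : tree_rank i = (3 * 2 ^ i)%N.
Proof. by elim: i => // i IH; rewrite /= IH expnS; lia. Qed.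

Lemma ord3_shift c c' : [|| c' == c, c' == c + 1 | c' == c + 1 *+ 2].
Proof. by elim/ord3P: c; elim/ord3P: c'. Qed.

Lemma ord3_shift_ne c :
  [/\ (c + 1 == c) = false, (c + 1 *+ 2 == c) = false
    & (c + 1 *+ 2 == c + 1) = false].
Proof. by elim/ord3P: c. Qed.

Lemma axes_var_rel c a b :
  a * axes_var k (c + 1) + b * axes_var k (c + 1 *+ 2) = 0 <->
  axis (c + 1) a = 0 /\ axis (c + 1 *+ 2) b = 0.
Proof.
have [h1 h2 h3] := ord3_shift_ne c; split=> [h|[ha hb]].
  have axh c' := congr1 (axis c') h.
  move: (axh (c + 1)) (axh (c + 1 *+ 2)).
  rewrite !rmorphD !rmorphM !rmorph0 /= !axis_var !eqxx h3 eq_sym h3.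
  by rewrite !mulr0 addr0 add0r -['X]expr1 => /polyMX_eq0 -> /polyMX_eq0 ->.
apply: axis_inj => c'; rewrite rmorphD !rmorphM rmorph0 /= !axis_var.
case/or3P: (ord3_shift c c') => /eqP ->.
- by rewrite h1 h2 !mulr0 addr0.
- by rewrite ha h3 mulr0 mul0r addr0.
- by rewrite hb mul0r addr0 eq_sym h3 mulr0.
Qed.

(** An element zero on one axis vanishes at the origin, hence is divisible by X on the other two;
    lifting the quotients gives the coefficients. *)
Lemma axis_eq0P c b : axis c b = 0 <->
  exists a a', b = a * axes_var k (c + 1) + a' * axes_var k (c + 1 *+ 2).
Proof.
have [h1 h2 h3] := ord3_shift_ne c; split=> [hb|[a [a' ->]]]; last first.
  by rewrite rmorphD !rmorphM /= !axis_var h1 h2 !mulr0 addr0.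
have dvX c' : exists p, axis c' b = p * 'X.
  have /factor_theorem[p pE] : root (axis c' b) 0.
    by rewrite /root horner_coef0 (axis_coef0 c' c) hb coef0.
  by exists p; rewrite pE subr0.
have [[p pE] [p' p'E]] := (dvX (c + 1), dvX (c + 1 *+ 2)).
exists (axis_lift (c + 1) p), (axis_lift (c + 1 *+ 2) p'); apply: axis_inj => c'.
rewrite rmorphD !rmorphM /= !axis_var !axis_lift_axis.
case/or3P: (ord3_shift c c') => /eqP ->.
- by rewrite hb h1 h2 !mulr0 addr0.
- by rewrite eqxx h3 mulr0 addr0.
- by rewrite eqxx [c + 1 == _]eq_sym h3 mulr0 add0r.
Qed.

Lemma tree_diff_mul i (a b : 'rV[B]_(tree_rank i)) t :
  (row_mx a b *m tree_diff i) 0 t =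
  a 0 t * axes_var k (tree_axis t + 1) + b 0 t * axes_var k (tree_axis t + 1 *+ 2).
Proof. by rewrite mul_row_col !mul_mx_diag !mxE. Qed.

Lemma tree_ann_im i (u : 'rV[B]_(tree_rank i)) :
  tree_ann u <-> exists w : 'rV_(tree_rank i.+1), u = w *m tree_diff i.
Proof.
split=> [ann|[w ->] s]; last first.
  rewrite -[w]hsubmxK tree_diff_mul; apply/axis_eq0P.
  by exists (lsubmx w 0 s), (rsubmx w 0 s).
have /fin_all_exists[a aP] s := (axis_eq0P (tree_axis s) (u 0 s)).1 (ann s).
have /fin_all_exists[a' a'P] s := aP s.
exists (row_mx (\row_s a s) (\row_s a' s)); apply/rowP => t.
by rewrite tree_diff_mul !mxE -a'P.
Qed.

Lemma tree_ann_ker i (u : 'rV[B]_(tree_rank i.+1)) :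
  u *m tree_diff i = 0 <-> tree_ann u.
Proof.
rewrite -[u]hsubmxK; set a := lsubmx u; set b := rsubmx u.
have H : row_mx a b *m tree_diff i = 0 <-> forall t,
    axis (tree_axis t + 1) (a 0 t) = 0 /\ axis (tree_axis t + 1 *+ 2) (b 0 t) = 0.
  split=> [/rowP h t|h].
    by apply/axes_var_rel; rewrite -tree_diff_mul h mxE.
  by apply/rowP => t; rewrite tree_diff_mul [RHS]mxE; apply/axes_var_rel; exact: h.
rewrite H; split=> [h s|h t].
  by rewrite /tree_axis -/tree_axis mxE; case: splitP => t _; case: (h t).
split; [have := h (lshift _ t) | have := h (rshift _ t)].
  by rewrite /tree_axis -/tree_axis row_mxEl (unsplitK (inl t)).
by rewrite /tree_axis -/tree_axis row_mxEr (unsplitK (inr t)).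
Qed.

Let f (c : 'I_(tree_rank 0)) : B := axes_var k c ^+ e.

Let f_homog s : axes_homog e (f s). Proof. exact: axes_homog_varX. Qed.

Let df_homog i s t : axes_homog 1 (tree_diff i s t).
Proof.
rewrite mxE; case: split => s'; rewrite !mxE;
  by (case: eqP => _; [apply: axes_homog_var | apply: axes_homog0]).
Qed.

Let df_exact0 (u : 'rV[B]_(tree_rank 0)) :
  \sum_s u 0 s * f s = 0 <-> exists w, u = w *m tree_diff 0.
Proof.
rewrite -tree_ann_im; split=> [h c|h].
  have := congr1 (axis c) h; rewrite rmorph0 rmorph_sum /= (bigD1 c) //= big1.
    by rewrite addr0 rmorphM rmorphXn /= axis_var eqxx => /polyMX_eq0.
  move=> c' nc; rewrite rmorphM rmorphXn /= axis_var (negbTE nc).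
  by rewrite expr0n (gtn_eqF e_gt0) mulr0.
apply: big1 => c _; apply: axis_inj => c'.
rewrite rmorph0 rmorphM rmorphXn /= axis_var; case: eqP => [<-|_].
  by rewrite (h c) mul0r.
by rewrite expr0n (gtn_eqF e_gt0) mulr0.
Qed.

Let df_exact i (u : 'rV[B]_(tree_rank i.+1)) :
  u *m tree_diff i = 0 <-> exists w, u = w *m tree_diff i.+1.
Proof. by rewrite tree_ann_ker tree_ann_im. Qed.

Lemma deg_inf_betti : exists2 M : gradedModule k,
  finite_length M & is_betti_table M (pure_table (DegInf lt_d)).
Proof.
exists (cyclic_graded f_homog d0).
  apply: (@cyclic_finite_length _ _ _ _ _ _ e) => c; apply/gen_idealP.
  exists (\row_s (s == c)%:R); rewrite (bigD1 c) //= big1 ?addr0 => [|c' nc].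
    by rewrite mxE eqxx mul1r.
  by rewrite mxE (negbTE nc) mul0r.
exists (cyclic_resolution f_homog d0 df_homog df_exact0 df_exact) => i j.
rewrite cyclic_tor_dim // pure_tableE; case: i => [|i] /=.
  by rewrite mul1r; case: eqP.
rewrite (_ : d0 + e%:Z = d1); last by rewrite /e; lia.
by rewrite tree_rankE; case: eqP => _; rewrite ?mulr0 // mulr1 natrM natrX.
Qed.

End DegInf.

End PureModules.

(** * The cycle of inclusions between the three cones *)

Lemma cone_sub (G G' : table -> Prop) v :
  (forall u, G u -> G' u) -> cone G v -> cone G' v.
Proof.
move=> sub [n [c [g [c0 gG vE]]]]; exists n, c, g; split=> // s.
exact: sub.
Qed.

Theorem corollary3p7 (k : fieldType) :
  (forall v : table, betti_cone_fl k v <-> pure_cone_fl v) /\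
  (forall v : table, pure_cone_fl v <-> facet_cone_fl v).
Proof.
have pure_betti v : pure_cone_fl v -> betti_cone_fl k v.
  apply: cone_sub => _ [[d|d0 d1 lt_d|d0 d1 lt_d] // _ ->].
    exact: deg1_betti.
  exact: deg_inf_betti.
have betti_facets v : betti_cone_fl k v -> facet_cone_fl v.
  move=> [n [c [g [c0 gB vE]]]]; apply: (facet_cone_comb c0 _ vE) => s.
  by have [M fl] := gB s; apply: betti_facet.
split=> v; split.
- by move/betti_facets/facet_pure.
- exact: pure_betti.
- by move/pure_betti/betti_facets.
- exact: facet_pure.
Qed.
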